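(* Let $(K,v)$ be a valued field of rank $1$ with $\mathrm{char}\,K=0$ and $\mathrm{char}\,Kv=p>0$, and assume that $K$ contains a primitive $p$-th root of unity. If $(K,v)$ admits a Kummer extension of degree $p$ with super-dependent defect, then it admits infinitely many distinct Kummer extensions of degree $p$ with super-dependent defect.
   Context: $vK$ is the value group (written additively), $Kv$ the residue field of $(K,v)$, and $\widetilde{vK}$ the divisible hull of $vK$. Rank $1$ means that $vK$ is nontrivial and archimedean ordered. An extension $(L|K,v)$ of valued fields is immediate if the canonical embeddings $vK\to vL$ and $Kv\to Lv$ are onto. A Galois defect extension of degree $p$ is an immediate Galois extension $(L|K,v)$ of degree $p$ such that $v$ has a unique extension from $K$ to $L$. For an element $a$ of a valued field extension of $(K,v)$, $v(a-K):=\{v(a-c)\mid c\in K\}$. For $\alpha\in\widetilde{vK}$, write $v(a-K)<\!\!|\,\alpha$ if there is $\beta\in\widetilde{vK}$ such that $v(a-c)\leq\beta<\alpha$ for all $c\in K$. A Kummer defect extension of degree $p$ is a Galois defect extension of degree $p$ generated by some $\eta\notin K$ with $\eta^p\in K$. Such a generator can always be chosen to be a $1$-unit, i.e. $v(\eta-1)>0$, and the set $v(\eta-K)$ does not depend on the choice of the generator $\eta$ as long as $\eta$ is a $1$-unit with $\eta^p\in K$. A Kummer extension of degree $p$ has super-dependent defect if it is a Kummer defect extension of degree $p$ and, for a generator $\eta$ that is a $1$-unit with $\eta^p\in K$, \[ v(\eta-K)<\!\!|\,\frac{vp}{p}. \] *)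

(* Defs.v *)
From HB Require Import structures.
From mathcomp Require Import all_boot all_order all_algebra all_field.

Set Implicit Arguments.
Unset Strict Implicit.
Unset Printing Implicit Defensive.

Import Order.TTheory GRing.Theory Num.Theory.

Local Open Scope ring_scope.
Local Open Scope quotient_scope.

HB.mixin Record isOrderedGroup G of Num.POrderedZmodule G := {
  og_total : total (<=%R : rel G);
  ogD2l : forall x y z : G, x <= y -> z + x <= z + y
}.

(* Totally ordered abelian groups, written additively. *)
#[short(type="orderedGroupType")]
HB.structure Definition OrderedGroup :=
  { G of isOrderedGroup G & Num.POrderedZmodule G }.

(* Nontrivial and archimedean; a valuation has rank 1 when its value group
   satisfies this. *)
Definition rank1 (G : orderedGroupType) : Prop :=
  (exists g : G, g != 0) /\
  forall x y : G, 0 < x -> exists n : nat, y <= x *+ n.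

(* [Frac g n] is the formal fraction g / (n + 1). Every element of the
   divisible hull of G has such a form; fractions are not identified, but are
   compared by cross-multiplication, which is the order of the divisible
   hull. *)
Record divHull (G : Type) := Frac { dh_num : G; dh_den1 : nat }.

Definition dh_den G (a : divHull G) : nat := (dh_den1 a).+1.

(* g / n, for n > 0. *)
Definition dh_div (G : Type) (g : G) (n : nat) : divHull G := Frac g n.-1.

Definition dh_map (G H : Type) (f : G -> H) (a : divHull G) : divHull H :=
  Frac (f (dh_num a)) (dh_den1 a).

Definition dh_le (G : orderedGroupType) (a b : divHull G) : bool :=
  dh_num a *+ dh_den b <= dh_num b *+ dh_den a.

Definition dh_lt (G : orderedGroupType) (a b : divHull G) : bool :=
  dh_num a *+ dh_den b < dh_num b *+ dh_den a.

(* Krull valuations with value group exactly G. The value at 0 is infinity by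
   convention, so [vfun 0 : G] is meaningless and must never be used. *)
Record valuation (K : fieldType) (G : orderedGroupType) := Valuation {
  vfun :> K -> G;
  vfunM : forall x y, x != 0 -> y != 0 -> vfun (x * y) = vfun x + vfun y;
  vfunD : forall x y, x != 0 -> y != 0 -> x + y != 0 ->
    Order.min (vfun x) (vfun y) <= vfun (x + y);
  vfun_onto : forall g, exists2 x, x != 0 & vfun x = g
}.

Section ResidueField.
Variables (K : fieldType) (G : orderedGroupType) (v : valuation K G).

Lemma vfun1 : v 1 = 0.
Proof.
have := vfunM v (oner_neq0 K) (oner_neq0 K).
by rewrite mulr1 -{1}[v 1]addr0 => /addrI.
Qed.

Lemma vfunN1 : v (-1) = 0.
Proof.
have N1 : (-1 : K) != 0 by rewrite oppr_eq0 oner_eq0.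
have e : v (-1) + v (-1) = 0 by rewrite -(vfunM v) // mulrNN mulr1 vfun1.
apply: le_anti; case/orP: (og_total (v (-1)) 0) => h; rewrite h ?andbT /=;
  by have := ogD2l _ _ (v (-1)) h; rewrite e addr0.
Qed.

Lemma vfunN x : x != 0 -> v (- x) = v x.
Proof.
move=> x0; rewrite -mulN1r (vfunM v) ?oppr_eq0 ?oner_eq0 //.
by rewrite vfunN1 add0r.
Qed.

Definition valring : {pred K} := fun x => (x == 0) || (0 <= v x).

Definition valideal : {pred K} := fun x => (x == 0) || (0 < v x).

Lemma valring_subring : subring_closed valring.
Proof.
split; rewrite ?unfold_in.
- by rewrite vfun1 lexx orbT.
- move=> x y; rewrite !unfold_in.
  have [->|x0] /= := eqVneq x 0; have [->|y0] //= := eqVneq y 0;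
    rewrite ?sub0r ?oppr0 ?eqxx ?oppr_eq0 ?subr0 ?(negPf x0) ?(negPf y0) //=.
  + by move=> _; rewrite vfunN.
  + by move=> vx _; rewrite addr0 vx orbT.
  + move=> vx vy; have [//|xy0] /= := eqVneq (x - y) 0.
    apply: le_trans (vfunD v _ _ xy0); rewrite ?oppr_eq0 //.
    by rewrite /Order.min vfunN //; case: ifP.
- move=> x y; rewrite !unfold_in mulf_eq0.
  have [//|x0] /= := eqVneq x 0; have [//|y0] //= := eqVneq y 0.
  move=> vx vy; rewrite (vfunM v) //; apply: le_trans vx _.
  by rewrite -{1}[v x]addr0 ogD2l.
Qed.

HB.instance Definition _ :=
  GRing.isSubringClosed.Build K valring valring_subring.

Definition valringType := {x : K | x \in valring}.
HB.instance Definition _ := SubChoice.on valringType.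
HB.instance Definition _ :=
  [SubChoice_isSubComNzRing of valringType by <:].

Definition max_ideal : {pred valringType} := fun x => sval x \in valideal.

Lemma max_ideal_closed : idealr_closed max_ideal.
Proof.
have oD (a b : G) : 0 <= a -> 0 < b -> 0 < a + b.
  by move=> a0 b0; apply: lt_le_trans b0 _; rewrite addrC -{1}[b]addr0 ogD2l.
split; rewrite ?unfold_in /=.
- by rewrite eqxx.
- by rewrite oner_eq0 vfun1 ltxx.
move=> [a Ha] [x Hx] [y Hy]; rewrite !unfold_in /= => {Hx Hy}.
move: Ha; rewrite unfold_in => Ha vx vy.
have {Ha vx}: (a * x == 0) || (0 < v (a * x)).
  rewrite mulf_eq0.
  have [//|a0] /= := eqVneq a 0; have [//|x0] /= := eqVneq x 0.
  rewrite (vfunM v) //; apply: oD.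
    by move: Ha; rewrite (negPf a0).
  by move: vx; rewrite (negPf x0).
move: (a * x) => z; have [->|z0] /= := eqVneq z 0; first by rewrite add0r.
move=> vz; move: vy.
have [->|y0] /= := eqVneq y 0; first by rewrite addr0 vz orbT.
move=> vy; have [//|zy0] /= := eqVneq (z + y) 0.
by apply: lt_le_trans (vfunD v _ _ zy0); rewrite // /Order.min; case: ifP.
Qed.

HB.instance Definition _ :=
  isIdealr.Build valringType max_ideal max_ideal_closed.

Definition residueField := {ideal_quot max_ideal}.

(* The residue of x; only meaningful when x lies in the valuation ring. *)
Definition residue (x : K) : residueField :=
  \pi_residueField (insubd (0 : valringType) x).

End ResidueField.

Section ValuedExtension.
Variables (K : fieldType) (G : orderedGroupType) (v : valuation K G).

(* w restricts to v, with phi the canonical embedding vK -> vL. *)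
Definition extends (L : fieldExtType K) (H : orderedGroupType)
    (w : valuation L H) (phi : {additive G -> H}) : Prop :=
  {mono phi : a b / a <= b} /\ forall x : K, x != 0 -> w x%:A = phi (v x).

(* The canonical embedding Kv -> Lv sends the residue of x to that of x%:A. *)
Definition immediate (L : fieldExtType K) (H : orderedGroupType)
    (w : valuation L H) (phi : {additive G -> H}) : Prop :=
  [/\ extends w phi,
      forall h : H, exists g : G, phi g = h
    & forall z : residueField w,
        exists2 x : K, x \in valring v & residue w x%:A = z].

(* Valuations are identified when they have the same valuation ring. *)
Definition unique_extension (L : fieldExtType K) (H : orderedGroupType)
    (w : valuation L H) : Prop :=
  forall (H' : orderedGroupType) (w' : valuation L H')
    (phi' : {additive G -> H'}), extends w' phi' -> valring w' =i valring w.

Definition Galois_defect (p : nat) (L : splittingFieldType K)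
    (H : orderedGroupType) (w : valuation L H) (phi : {additive G -> H}) :=
  [/\ galois 1 {:L}, \dim {:L} = p, immediate w phi & unique_extension w].

Definition Kummer_generator (p : nat) (L : fieldExtType K) (eta : L) : Prop :=
  [/\ eta \notin 1%VS, eta ^+ p \in 1%VS & <<1; eta>>%VS = {:L}%VS].

Definition Kummer_defect (p : nat) (L : splittingFieldType K)
    (H : orderedGroupType) (w : valuation L H) (phi : {additive G -> H}) :=
  Galois_defect p w phi /\ exists eta : L, Kummer_generator p eta.

Definition one_unit (L : fieldType) (H : orderedGroupType)
    (w : valuation L H) (x : L) : Prop := x - 1 \in valideal w.

(* v(a - K) <<| alpha, for a outside K (so that all the values are finite) and
   alpha in the divisible hull of vK. The comparison of w (a - c), which lies
   in vL, with beta takes place in the divisible hull of vL. *)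
Definition strongly_below (L : fieldExtType K) (H : orderedGroupType)
    (w : valuation L H) (phi : {additive G -> H}) (a : L)
    (alpha : divHull G) : Prop :=
  exists beta : divHull G,
    (forall c : K, dh_le (dh_div (w (a - c%:A)) 1) (dh_map phi beta)) /\
    dh_lt beta alpha.

Definition super_dependent (p : nat) (L : splittingFieldType K)
    (H : orderedGroupType) (w : valuation L H) (phi : {additive G -> H}) :=
  Kummer_defect p w phi /\
  exists eta : L, [/\ Kummer_generator p eta, one_unit w eta
    & strongly_below w phi eta (dh_div (v p%:R) p)].

(* L, with a suitable extension of v (unique up to equivalence), is a Kummer
   extension of degree p of (K, v) with super-dependent defect. *)
Definition super_dependent_Kummer_ext (p : nat) (L : splittingFieldType K) :=
  exists (H : orderedGroupType) (w : valuation L H) (phi : {additive G -> H}),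
    super_dependent p w phi.

End ValuedExtension.

Definition K_isomorphic (K : fieldType) (L L' : fieldExtType K) : Prop :=
  exists f : {lrmorphism L -> L'}, bijective f.

(* Main.v *)
Require Import Defs.
From HB Require Import structures.
From mathcomp Require Import all_boot all_order all_fingroup all_algebra all_field.
From Stdlib Require Import ClassicalEpsilon.

Set Implicit Arguments.
Unset Strict Implicit.
Unset Printing Implicit Defensive.

Import Order.TTheory GRing.Theory Num.Theory.
Local Open Scope ring_scope.

(** Let eta be a one-unit generating the given extension, a = eta ^+ p, and let
    delta c be the value of eta - c for c in K; it lies in vK because the
    extension is immediate. All that is used about eta is the following
    ([super_dependent_distance]). There is no largest delta c; if delta c is
    less than delta c' then c' - c has value delta c; and a - y ^+ p has value
    p delta y for every integral y in K. The last fact holds because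
    (eta - y) ^+ p and a - y ^+ p agree modulo p, and super-dependence says
    that p delta y stays below v p, at a positive distance.

    Perturbing the radicand. If b - a has value above every p delta c, then a
    p-th root of b is exactly as far from each c as eta is, and it generates
    again an extension with super-dependent defect ([Kummer_extension_exists]).
    The valuation of this extension can be written down: an element is the
    value at the root of a polynomial f of degree less than p, and its value is
    v (f c) for every c close enough to eta. The point is that v (f c) does not
    change any more once c is close. To see this, expand f at c and consider
    the Gauss valuation for the radius delta c; the last index at which it is
    attained counts the roots of f in the ball around c that just reaches eta.
    This index can only decrease when c approaches eta, so it has a final value
    n(f) ([germ]); n is additive on products, and v (f c) is finally constant
    as soon as n(f) = 0. Let q have the least degree m among the polynomials
    with n(q) > 0, and s = n(q), so that s <= m. Division by q shows that every
    n(f) has the form j s with j m <= deg f ([germ_index_multiple]). Since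
    n('X^p - b) = p, there is j with p = j s and j m <= p; hence m = s divides
    p. But m = 1 would provide a best approximation of eta in K, so m = p, and
    n(f) = 0 for every f of smaller degree ([germ_small_degree]). The same
    Taylor expansions compute every extension of v to the new field, which
    gives uniqueness of the extension, and immediacy.

    Infinitely many classes. Put b_i = a (1 + x_i) with
    x_i = t_i ^+ p (a - c_i ^+ p), where the values of the x_i decrease and
    stay above all p delta c, and where p (v t_j + delta c) is below v x_i for
    i < j and all c. Such t_j and c_j exist since in rank 1 some delta c comes
    as close as desired to an upper bound of all of them
    ([refinement_exists]). By Kummer theory an isomorphism between two of the
    extensions yields b_j = b_i ^+ k z ^+ p, for i and j in either order. Both
    radicands agree with a up to elements of value above all p delta c. If k is
    not 1 modulo p this makes a itself a p-th power up to such an element,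
    which was excluded ([Kummer_class_near]). Otherwise, after inverting z if
    necessary, 1 + x_j = (1 + x_i) z ^+ p with i < j, and then (z - 1) ^+ p is
    so close to x_j that a is too close to the p-th power of
    c_j + (z - 1) / t_j ([radicand_distinct]). *)

(** * Ordered abelian groups *)

Section OrderedGroupTheory.
Variable G : orderedGroupType.
Implicit Types (x y z t g : G) (n : nat).

Lemma og_leD2l z x y : (z + x <= z + y) = (x <= y).
Proof.
apply/idP/idP; last exact: ogD2l.
by move=> /(ogD2l _ _ (- z)); rewrite !addKr.
Qed.

Lemma og_leD2r z x y : (x + z <= y + z) = (x <= y).
Proof. by rewrite ![_ + z]addrC og_leD2l. Qed.

Lemma og_ltNge x y : (x < y) = ~~ (y <= x).
Proof.
apply/idP/idP => [h|]; first by apply/negP => /(lt_le_trans h); rewrite ltxx.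
by case/orP: (og_total x y) => h; rewrite ?h // lt_neqAle h andbT => /negP nh;
  apply/eqP => e; apply: nh; rewrite e.
Qed.

Lemma og_leNgt x y : (x <= y) = ~~ (y < x).
Proof. by rewrite og_ltNge negbK. Qed.

Lemma og_ltD2l z x y : (z + x < z + y) = (x < y).
Proof. by rewrite !og_ltNge og_leD2l. Qed.

Lemma og_ltD2r z x y : (x + z < y + z) = (x < y).
Proof. by rewrite !og_ltNge og_leD2r. Qed.

Lemma og_leD x y z t : x <= y -> z <= t -> x + z <= y + t.
Proof. by move=> h k; apply: (@le_trans _ _ (y + z)); rewrite ?og_leD2r ?og_leD2l. Qed.

Lemma og_lt_leD x y z t : x < y -> z <= t -> x + z < y + t.
Proof. by move=> h k; apply: (@lt_le_trans _ _ (y + z)); rewrite ?og_ltD2r ?og_leD2l. Qed.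

Lemma og_le_ltD x y z t : x <= y -> z < t -> x + z < y + t.
Proof. by move=> h k; rewrite addrC [y + t]addrC og_lt_leD. Qed.

Lemma og_lt_min g x y : g < x -> g < y -> g < Order.min x y.
Proof. by rewrite /Order.min; case: ifP. Qed.

Lemma og_le_min g x y : g <= x -> g <= y -> g <= Order.min x y.
Proof. by rewrite /Order.min; case: ifP. Qed.

Lemma og_subr_gt0 x y : (0 < y - x) = (x < y).
Proof. by rewrite -(og_ltD2r x 0) add0r subrK. Qed.

Lemma og_leBlDr x y z : (x - y <= z) = (x <= z + y).
Proof. by rewrite -(og_leD2r y (x - y)) subrK. Qed.

Lemma og_ltBlDr x y z : (x - y < z) = (x < z + y).
Proof. by rewrite -(og_ltD2r y (x - y)) subrK. Qed.

Lemma og_ltBrDr x y z : (x < y - z) = (x + z < y).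
Proof. by rewrite -(og_ltD2r z x) subrK. Qed.

Lemma og_leMn n x y : x <= y -> x *+ n <= y *+ n.
Proof. by move=> h; elim: n => // n IHn; rewrite !mulrS og_leD. Qed.

Lemma og_ltMn n x y : (0 < n)%N -> x < y -> x *+ n < y *+ n.
Proof.
by case: n => // n _ h; rewrite !mulrS og_lt_leD // og_leMn // ltW.
Qed.

Lemma og_lepMn n x y : (0 < n)%N -> (x *+ n <= y *+ n) = (x <= y).
Proof.
move=> n0; apply/idP/idP; last exact: og_leMn.
by apply: contraTT; rewrite -!og_ltNge; apply: og_ltMn.
Qed.

Lemma og_ltpMn n x y : (0 < n)%N -> (x *+ n < y *+ n) = (x < y).
Proof. by move=> n0; rewrite !og_ltNge og_lepMn. Qed.

Lemma og_mulrn_inj n x y : (0 < n)%N -> x *+ n = y *+ n -> x = y.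
Proof. by move=> n0 e; apply: le_anti; rewrite -(og_lepMn x y n0) -(og_lepMn y x n0) e lexx. Qed.

Lemma og_mulrn_eq0 n x : (0 < n)%N -> x *+ n = 0 -> x = 0.
Proof. by move=> n0 e; apply: (og_mulrn_inj n0); rewrite mul0rn. Qed.

Lemma og_leMn2 m n x : 0 <= x -> (m <= n)%N -> x *+ m <= x *+ n.
Proof.
move=> x0 /subnK <-; rewrite mulrnDr -{1}[x *+ m]add0r og_leD2r.
by rewrite -(mul0rn _ (n - m)) og_leMn.
Qed.

Lemma og_ltMn2 m n x : 0 < x -> (m < n)%N -> x *+ m < x *+ n.
Proof.
move=> x0 /subnK <-; rewrite addnS -addSn mulrnDr mulrSr.
rewrite -{1}[x *+ m]add0r og_ltD2r -[0]addr0 og_le_ltD //.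
by rewrite -(mul0rn _ (n - m.+1)) og_leMn // ltW.
Qed.

End OrderedGroupTheory.

(** * Balls of a valuation *)

Section Balls.
Variables (K : fieldType) (G : orderedGroupType) (v : valuation K G).
Implicit Types (x y : K) (g h : G).

(** [vge g] and [vgt g] are the closed and the open ball of radius g around 0.
    The value of 0 is a junk element of G, so that 0 has to be put in by hand. *)
Definition vge g x := (x == 0) || (g <= v x).
Definition vgt g x := (x == 0) || (g < v x).

Lemma vge0 g : vge g 0. Proof. by rewrite /vge eqxx. Qed.
Lemma vgt0 g : vgt g 0. Proof. by rewrite /vgt eqxx. Qed.

Lemma vgeE g x : x != 0 -> vge g x = (g <= v x).
Proof. by rewrite /vge => /negPf->. Qed.

Lemma vgtE g x : x != 0 -> vgt g x = (g < v x).
Proof. by rewrite /vgt => /negPf->. Qed.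

Lemma vgtW g x : vgt g x -> vge g x.
Proof. by rewrite /vge /vgt => /orP[->//|/ltW->]; rewrite orbT. Qed.

Lemma vge_le g h x : g <= h -> vge h x -> vge g x.
Proof. by rewrite /vge => gh /orP[->//|/(le_trans gh)->]; rewrite orbT. Qed.

Lemma vgt_le g h x : g <= h -> vgt h x -> vgt g x.
Proof. by rewrite /vgt => gh /orP[->//|/(le_lt_trans gh)->]; rewrite orbT. Qed.

Lemma vge_gt g h x : g < h -> vge h x -> vgt g x.
Proof. by rewrite /vgt /vge => gh /orP[->//|/(lt_le_trans gh)->]; rewrite orbT. Qed.

Lemma vgeN g x : vge g (- x) = vge g x.
Proof. by rewrite /vge oppr_eq0; case: eqVneq => //= x0; rewrite vfunN. Qed.

Lemma vgtN g x : vgt g (- x) = vgt g x.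
Proof. by rewrite /vgt oppr_eq0; case: eqVneq => //= x0; rewrite vfunN. Qed.

Lemma vgeD g x y : vge g x -> vge g y -> vge g (x + y).
Proof.
have [->|x0] := eqVneq x 0; first by rewrite add0r.
have [->|y0] := eqVneq y 0; first by rewrite addr0.
rewrite (vgeE _ x0) (vgeE _ y0) => hx hy; have [->|xy0] := eqVneq (x + y) 0; first exact: vge0.
by rewrite vgeE //; apply: le_trans (vfunD v x0 y0 xy0); apply: og_le_min.
Qed.

Lemma vgtD g x y : vgt g x -> vgt g y -> vgt g (x + y).
Proof.
have [->|x0] := eqVneq x 0; first by rewrite add0r.
have [->|y0] := eqVneq y 0; first by rewrite addr0.
rewrite (vgtE _ x0) (vgtE _ y0) => hx hy; have [->|xy0] := eqVneq (x + y) 0; first exact: vgt0.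
by rewrite vgtE //; apply: lt_le_trans (vfunD v x0 y0 xy0); apply: og_lt_min.
Qed.

Lemma vgeB g x y : vge g x -> vge g y -> vge g (x - y).
Proof. by move=> hx hy; rewrite vgeD ?vgeN. Qed.

Lemma vge_sum (I : Type) (r : seq I) (P : pred I) (F : I -> K) g :
  (forall i, P i -> vge g (F i)) -> vge g (\sum_(i <- r | P i) F i).
Proof. exact: (big_ind (vge g) (vge0 g) (@vgeD g)). Qed.

Lemma vgt_sum (I : Type) (r : seq I) (P : pred I) (F : I -> K) g :
  (forall i, P i -> vgt g (F i)) -> vgt g (\sum_(i <- r | P i) F i).
Proof. exact: (big_ind (vgt g) (vgt0 g) (@vgtD g)). Qed.

Lemma vgeM g h x y : vge g x -> vge h y -> vge (g + h) (x * y).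
Proof.
have [->|x0] := eqVneq x 0; first by rewrite mul0r !vge0.
have [->|y0] := eqVneq y 0; first by rewrite mulr0 !vge0.
by rewrite !vgeE ?mulf_neq0 // vfunM //; apply: og_leD.
Qed.

Lemma vgtMl g h x y : vgt g x -> vge h y -> vgt (g + h) (x * y).
Proof.
have [->|x0] := eqVneq x 0; first by rewrite mul0r !vgt0.
have [->|y0] := eqVneq y 0; first by rewrite mulr0 !vgt0.
by rewrite vgeE // !vgtE ?mulf_neq0 // vfunM //; apply: og_lt_leD.
Qed.

Lemma vgtMr g h x y : vge g x -> vgt h y -> vgt (g + h) (x * y).
Proof. by rewrite mulrC addrC => hx hy; apply: vgtMl. Qed.

Lemma vge0M g x y : vge 0 x -> vge g y -> vge g (x * y).
Proof. by move=> hx hy; rewrite -[g]add0r vgeM. Qed.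

Lemma vgeMn n g x : vge g x -> vge g (x *+ n).
Proof. by move=> h; elim: n => [|n IHn]; rewrite ?mulr0n ?vge0 // mulrS vgeD. Qed.

Lemma vge1 : vge 0 1.
Proof. by rewrite vgeE ?oner_neq0 // vfun1. Qed.

Lemma vgeX n g x : vge g x -> vge (g *+ n) (x ^+ n).
Proof.
move=> h; elim: n => [|n IHn]; first by rewrite mulr0n expr0 vge1.
by rewrite mulrS exprS vgeM.
Qed.

Lemma vfunX n x : x != 0 -> v (x ^+ n) = v x *+ n.
Proof.
move=> x0; elim: n => [|n IHn]; first by rewrite expr0 vfun1.
by rewrite exprS mulrS vfunM ?expf_neq0 // IHn.
Qed.

Lemma vfunV x : x != 0 -> v x^-1 = - v x.
Proof.
move=> x0; apply/eqP; rewrite -addr_eq0 -vfunM ?invr_eq0 //.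
by rewrite mulVf ?vfun1.
Qed.

Lemma vfunDl x y : x != 0 -> vgt (v x) y -> x + y != 0 /\ v (x + y) = v x.
Proof.
move=> x0; have [->|y0] := eqVneq y 0; first by rewrite addr0.
rewrite vgtE // => xy.
have xy0 : x + y != 0.
  by apply: contraTneq xy => /eqP; rewrite addr_eq0 => /eqP->; rewrite vfunN // ltxx.
split=> //; apply: le_anti; apply/andP; split; last first.
  by apply: le_trans (vfunD v x0 y0 xy0); rewrite og_le_min // ltW.
rewrite og_leNgt; apply/negP => h.
have ny0 : - y != 0 by rewrite oppr_eq0.
have := vfunD v xy0 ny0; rewrite addrK => /(_ x0).
rewrite og_leNgt => /negP; apply; apply: og_lt_min => //.
by rewrite vfunN.
Qed.

End Balls.

Lemma vge_valring (K : fieldType) (G : orderedGroupType) (v : valuation K G) x :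
  (x \in valring v) = vge v 0 x.
Proof. by []. Qed.

Lemma vgt_valideal (K : fieldType) (G : orderedGroupType) (v : valuation K G) x :
  (x \in valideal v) = vgt v 0 x.
Proof. by []. Qed.

(** * Gauss valuations of polynomials *)

Section GaussValuation.
Variables (K : fieldType) (G : orderedGroupType) (v : valuation K G).
Implicit Types (f g : {poly K}) (d m : G).

(** The Gauss valuation of f for the radius d is the minimum m of the
    v f`_i + d *+ i, and n is the last index at which the minimum is attained.
    When n is the last such index, it is the number of roots of f in the closed
    ball of radius d around 0. *)
Definition gauss_lead d f (n : nat) m : Prop :=
  [/\ f`_n != 0, v f`_n = m - d *+ n,
      forall i, vge v (m - d *+ i) f`_i
    & forall i, (n < i)%N -> vgt v (m - d *+ i) f`_i].

Lemma gauss_lead_exists d f : f != 0 -> exists n m, gauss_lead d f n m.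
Proof.
elim/poly_ind: f => [|f c IHf]; first by rewrite eqxx.
have coefE i : (f * 'X + c%:P)`_i = if i is j.+1 then f`_j else c.
  by rewrite coefD coefMX coefC; case: i => [|i] /=; rewrite ?add0r ?addr0.
have [->|f0] := eqVneq f 0.
  rewrite mul0r add0r polyC_eq0 => c0.
  exists 0%N, (v c); split; rewrite ?coefC ?mulr0n ?subr0 //=.
    by case=> [|i]; rewrite coefC /= ?vge0 // mulr0n subr0 vgeE.
  by case=> [|i]; rewrite // coefC vgt0.
move=> _; have {IHf} [n [m [fn0 vfn fge fgt]]] := IHf f0.
have E i : m + d - d *+ i.+1 = m - d *+ i.
  by rewrite mulrS opprD addrA addrK.
have [vc|/negP vc] := boolP (vge v (m + d) c).
  exists n.+1, (m + d); split; rewrite ?coefE ?E //.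
    by case=> [|i]; rewrite coefE ?E // mulr0n subr0.
  by case=> // i ni; rewrite coefE E fgt.
have c0 : c != 0 by apply/eqP => c0; apply: vc; rewrite c0 vge0.
have {}vc : v c < m + d by rewrite og_ltNge; apply/negP => h; apply: vc; rewrite vgeE.
have H i : vgt v (v c - d *+ i.+1) f`_i.
  by apply: vge_gt (fge i); rewrite -E og_ltD2r.
exists 0%N, (v c); split; rewrite ?coefE ?mulr0n ?subr0 //.
  by case=> [|i]; rewrite coefE; [rewrite mulr0n subr0 vgeE | apply: vgtW].
by case=> // i _; rewrite coefE.
Qed.

Lemma gauss_lead_uniq d f n n' m m' :
  gauss_lead d f n m -> gauss_lead d f n' m' -> n = n' /\ m = m'.
Proof.
suff le k k' l l' : gauss_lead d f k l -> gauss_lead d f k' l' -> (k' <= k)%N.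
  move=> h h'; have e : n = n' by apply/eqP; rewrite eqn_leq (le _ _ _ _ h' h) (le _ _ _ _ h h').
  split=> //; case: h h' => _ h _ _ []; rewrite -e h => _ /addIr //.
move=> [fk vk gek gtk] [fk' vk' gek' gtk']; rewrite leqNgt; apply/negP => kk'.
have := gtk _ kk'; rewrite vgtE // vk' og_ltD2r og_ltNge.
by have := gek' k; rewrite vgeE // vk og_leD2r => ->.
Qed.

(** In the coefficient of index n + n' of the product, the only term that can
    reach the minimum is the one that pairs the last minimal coefficients. *)
Lemma gauss_leadM d f g n n' m m' :
  gauss_lead d f n m -> gauss_lead d g n' m' ->
  gauss_lead d (f * g) (n + n') (m + m').
Proof.
move=> [fn vfn gef gtf] [gn vgn geg gtg].
have E i (j : 'I_i.+1) :
    m + m' - d *+ i = (m - d *+ j) + (m' - d *+ (i - j)).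
  by rewrite addrACA -opprD -mulrnDr subnKC // -ltnS.
have ge i (j : 'I_i.+1) : vge v (m + m' - d *+ i) (f`_j * g`_(i - j)).
  by rewrite (E _ j) vgeM.
have gt i (j : 'I_i.+1) : (n < j)%N || (n' < i - j)%N ->
    vgt v (m + m' - d *+ i) (f`_j * g`_(i - j)).
  by rewrite (E _ j) => /orP[h|h]; [rewrite vgtMl ?gtf | rewrite vgtMr ?gtg].
have lt_nn' : (n < (n + n').+1)%N by rewrite ltnS leq_addr.
pose j0 := Ordinal lt_nn'.
have [h1 h2] : (f * g)`_(n + n') != 0 /\
    v (f * g)`_(n + n') = m + m' - d *+ (n + n').
  rewrite coefM (bigD1 j0) //= addKn.
  have -> : m + m' - d *+ (n + n') = v (f`_n * g`_n').
    by rewrite vfunM // vfn vgn addrACA -opprD -mulrnDr.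
  apply: vfunDl; first by rewrite mulf_neq0.
  apply: vgt_sum => j jj0; rewrite vfunM // vfn vgn addrACA -opprD -mulrnDr.
  apply: gt; have : (j != n :> nat) by [].
  rewrite neq_ltn => /orP[jn|->//]; apply/orP; right.
  by rewrite ltn_subRL ltn_add2r.
split=> // i; first by rewrite coefM; apply: vge_sum.
move=> ni; rewrite coefM; apply: vgt_sum => j _; apply: gt.
have [//|jn] := ltnP n j; apply/orP; right.
by rewrite ltn_subRL; apply: leq_ltn_trans ni; rewrite leq_add2r.
Qed.

Lemma gauss_leadD d f g n n' m m' :
  gauss_lead d f n m -> gauss_lead d g n' m' -> m < m' ->
  gauss_lead d (f + g) n m.
Proof.
move=> [fn vfn gef gtf] [gn vgn geg gtg] mm'.
have gt i : vgt v (m - d *+ i) g`_i.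
  by apply: vge_gt (geg i); rewrite og_ltD2r.
have [h1 h2] := vfunDl fn (eq_ind_r (fun z => vgt v z g`_n) (gt n) vfn).
split; rewrite ?coefD -?vfn //.
  by move=> i; rewrite coefD vgeD // vgtW.
by move=> i ni; rewrite coefD vgtD ?gtf.
Qed.

Lemma coef_XaddC_exp (e : K) k i :
  (('X + e%:P) ^+ k)`_i = e ^+ (k - i) *+ 'C(k, i).
Proof.
rewrite addrC exprDn coef_sum.
have H j : ((e%:P ^+ (k - j) * 'X ^+ j) *+ 'C(k, j))`_i =
    if i == j then e ^+ (k - j) *+ 'C(k, j) else 0.
  rewrite coefMn -rmorphXn /= coefCM coefXn.
  by case: eqP => _; rewrite ?mulr1 // mulr0 mul0rn.
under eq_bigr => j _ do rewrite H.
rewrite -big_mkcond /=.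
have [ki|ik] := ltnP k i.
  rewrite bin_small // mulr0n big_pred0 // => j; apply/negP => /eqP e1.
  by have := ltn_ord j; rewrite -e1 ltnS leqNgt ki.
by rewrite (big_pred1 (Ordinal (ik : (i < k.+1)%N))) // => j; rewrite eq_sym.
Qed.

Lemma coef_comp_XaddC f e i :
  (f \Po ('X + e%:P))`_i =
    \sum_(k < size f) f`_k * (e ^+ (k - i) *+ 'C(k, i)).
Proof.
rewrite comp_polyE coef_sum; apply: eq_bigr => k _.
by rewrite coefZ coef_XaddC_exp.
Qed.

(** Moving the centre by e and shrinking the ball from radius v e to a larger
    value d' can only lose roots. If none is lost, the coefficient of index n
    keeps its value, which tells how the Gauss valuation grows with the radius. *)
Lemma gauss_lead_recenter d d' e f n n' m m' :
  e != 0 -> v e = d -> d < d' ->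
  gauss_lead d f n m -> gauss_lead d' (f \Po ('X + e%:P)) n' m' ->
  (n' <= n)%N /\ (n' = n -> m' = m + (d' - d) *+ n).
Proof.
move=> e0 ve dd' [fn vfn gef gtf] [gn' vgn' geg' gtg'].
set g := f \Po _ in gn' vgn' geg' gtg'.
have E i k : (i <= k)%N -> m - d *+ i = (m - d *+ k) + d *+ (k - i).
  by move=> ik; rewrite -{1}(subnKC ik) mulrnDr opprD addrA subrK.
have ve' : vge v d e by rewrite vgeE ?ve.
have ge i k : vge v (m - d *+ i) (f`_k * (e ^+ (k - i) *+ 'C(k, i))).
  have [ki|ik] := ltnP k i; first by rewrite bin_small // mulr0n mulr0 vge0.
  by rewrite (E _ _ ik) vgeM // vgeMn // vgeX.
have gt i k : (n < k)%N -> vgt v (m - d *+ i) (f`_k * (e ^+ (k - i) *+ 'C(k, i))).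
  move=> nk; have [ki|ik] := ltnP k i; first by rewrite bin_small // mulr0n mulr0 vgt0.
  by rewrite (E _ _ ik) vgtMl ?gtf // vgeMn // vgeX.
have gtg i : (n < i)%N -> vgt v (m - d *+ i) g`_i.
  move=> ni; rewrite coef_comp_XaddC; apply: vgt_sum => k _.
  have [ki|ik] := ltnP k i; first by rewrite bin_small // mulr0n mulr0 vgt0.
  by apply: gt; apply: leq_trans ik.
have [gn vgn] : g`_n != 0 /\ v g`_n = m - d *+ n.
  have ns : (n < size f)%N.
    by rewrite ltnNge; apply: contraNN fn => /leq_sizeP->.
  rewrite coef_comp_XaddC (bigD1 (Ordinal ns)) //= subnn binn expr0 mulr1n mulr1.
  rewrite -vfn; apply: vfunDl => //; rewrite vfn; apply: vgt_sum => k kn.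
  have : (k != n :> nat) by []; rewrite neq_ltn => /orP[kn'|]; last exact: gt.
  by rewrite bin_small // mulr0n mulr0 vgt0.
split; last first.
  move=> e1; move: vgn'; rewrite e1 vgn => /eqP; rewrite -subr_eq => /eqP <-.
  by rewrite mulrnBl opprK addrA addrAC.
rewrite leqNgt; apply/negP => nn'.
have h1 := geg' n; rewrite vgeE // vgn in h1.
have h2 := gtg _ nn'; rewrite vgtE // vgn' in h2.
have {h1} h1 : m' <= m + (d' - d) *+ n.
  by move: h1; rewrite og_leBlDr mulrnBl addrA addrAC.
have {h2} h2 : m + (d' - d) *+ n' < m'.
  by move: h2; rewrite og_ltBrDr mulrnBl addrA addrAC.
have := lt_le_trans h2 h1; rewrite og_ltD2l og_ltNge => /negP; apply.
by apply: og_leMn2 (ltnW nn'); rewrite ltW // og_subr_gt0.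
Qed.

End GaussValuation.

(** * Gauss valuations on a shrinking sequence of balls *)

Section Germs.
Variables (K : fieldType) (G : orderedGroupType) (v : valuation K G).
(** [delta c] is the value of the difference between c and an element of some
    extension that K approximates without a best approximation. *)
Variable delta : K -> G.
Hypothesis deltaB : forall c c', delta c < delta c' ->
  c' - c != 0 /\ v (c' - c) = delta c.
Hypothesis delta_nomax : forall c, exists c', delta c < delta c'.
Implicit Types (f g : {poly K}).

Definition taylor c f := f \Po ('X + c%:P).

Lemma taylorM c : {morph taylor c : f g / f * g}.
Proof. by move=> f g; rewrite /taylor rmorphM. Qed.

Lemma taylorD c : {morph taylor c : f g / f + g}.
Proof. by move=> f g; rewrite /taylor rmorphD. Qed.

Lemma taylor_neq0 c f : f != 0 -> taylor c f != 0.
Proof.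
by rewrite -!size_poly_eq0 size_comp_poly2 // size_XaddC.
Qed.

Lemma taylor_coef0 c f : (taylor c f)`_0 = f.[c].
Proof. by rewrite -horner_coef0 horner_comp !hornerE. Qed.

Lemma taylor_recenter c c' f :
  taylor c' f = taylor c f \Po ('X + (c' - c)%:P).
Proof.
rewrite /taylor -comp_polyA; congr (_ \Po _).
by rewrite comp_polyD comp_polyX comp_polyC -addrA -polyCD subrK.
Qed.

Definition eventually (P : K -> Prop) :=
  exists c0, forall c, delta c0 < delta c -> P c.

Lemma eventually_and P Q :
  eventually P -> eventually Q -> eventually (fun c => P c /\ Q c).
Proof.
move=> [c0 h0] [c1 h1].
case/orP: (og_total (delta c0) (delta c1)) => h.
  by exists c1 => c h'; split; [apply: h0; apply: le_lt_trans h' | apply: h1].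
by exists c0 => c h'; split; [apply: h0 | apply: h1; apply: le_lt_trans h'].
Qed.

Lemma eventually_imp (P Q : K -> Prop) :
  (forall c, P c -> Q c) -> eventually P -> eventually Q.
Proof. by move=> h [c0 h0]; exists c0 => c /h0/h. Qed.

Lemma eventually_ex P : eventually P -> exists c, P c.
Proof. by move=> [c0 h0]; have [c /h0] := delta_nomax c0; exists c. Qed.

Lemma eventually_gt c0 : eventually (fun c => delta c0 < delta c).
Proof. by exists c0. Qed.

(** On all small balls the Gauss valuation of f is an affine function of the
    radius, with slope n and constant term m. In case n = 0 the constant
    coefficient strictly dominates, so that v (f c) is finally equal to m. *)
Definition germ f n m :=
  eventually (fun c => gauss_lead v (delta c) (taylor c f) n (m + delta c *+ n)).

Lemma ex_least (Q : nat -> Prop) :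
  (exists n, Q n) -> exists2 n, Q n & forall k, Q k -> (n <= k)%N.
Proof.
pose q n : bool := excluded_middle_informative (Q n).
have qP n : reflect (Q n) (q n) by apply: (iffP idP); rewrite /q; case: excluded_middle_informative.
move=> [n Qn]; have exq : exists n, q n by exists n; apply/qP.
by case: (ex_minnP exq) => k /qP Qk min; exists k => // j /qP; apply: min.
Qed.

(** The number of roots in the ball decreases when the ball shrinks. Its
    least value is the final one, because from there on it cannot change. *)
Lemma germ_exists f : f != 0 -> exists n m, germ f n m.
Proof.
move=> f0.
have [|n [c0 [m0 l0]] min] :=
    @ex_least (fun n => exists c m, gauss_lead v (delta c) (taylor c f) n m).
  have [n [m h]] := gauss_lead_exists v (delta 0) (taylor_neq0 0 f0).
  by exists n, 0, m.
exists n, (m0 - delta c0 *+ n), c0 => c dc.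
have [c0' vc] := deltaB dc.
have [n' [m' h]] := gauss_lead_exists v (delta c) (taylor_neq0 c f0).
have h' := h; rewrite (taylor_recenter c0 c) in h'.
have [n'n e] := gauss_lead_recenter c0' vc dc l0 h'.
have {n'n} n'n : n' = n by apply/eqP; rewrite eqn_leq n'n min //; exists c, m'.
by rewrite addrAC -addrA -mulrnBl -(e n'n) -n'n.
Qed.

Lemma germ_uniq f n n' m m' : germ f n m -> germ f n' m' -> n = n' /\ m = m'.
Proof.
move=> h h'; have [c [l l']] := eventually_ex (eventually_and h h').
by have [<- /addIr] := gauss_lead_uniq l l'.
Qed.

Lemma germM f g n n' m m' :
  germ f n m -> germ g n' m' -> germ (f * g) (n + n') (m + m').
Proof.
move=> h h'; apply: eventually_imp (eventually_and h h') => c [l l'].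
by rewrite mulrnDr addrACA taylorM; apply: gauss_leadM.
Qed.

(** Two Gauss valuations of different slopes n < n' differ by a strictly
    monotone function of the radius; so they are different on all small
    balls, and always in the same order. *)
Lemma germD f g n n' m m' : (n < n')%N -> germ f n m -> germ g n' m' ->
  germ (f + g) n m \/ germ (f + g) n' m'.
Proof.
move=> nn' h h'.
have [[c0 le0]|gt] := classic (exists c, m + delta c *+ n <= m' + delta c *+ n').
  left; apply: eventually_imp
    (eventually_and (eventually_gt c0) (eventually_and h h')) => c [c0c [l l']].
  rewrite taylorD; apply: gauss_leadD l l' _.
  have E x (k : nat) : x + delta c *+ k = x + delta c0 *+ k + (delta c - delta c0) *+ k.
    by rewrite mulrnBl addrA addrAC addrK.
  rewrite !(E _ n) (E m' n'); apply: og_le_ltD => //.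
  by apply: og_ltMn2; rewrite ?og_subr_gt0.
(* If the first case never occurs, g has the smaller Gauss valuation on every ball. *)
right; apply: eventually_imp (eventually_and h h') => c [l l'].
rewrite taylorD addrC; apply: gauss_leadD l' l _.
by rewrite og_ltNge; apply/negP => le; apply: gt; exists c.
Qed.

Lemma germ_polyC c : c != 0 -> germ c%:P 0 (v c).
Proof.
move=> c0; exists 0 => c' _; rewrite /taylor comp_polyC mulr0n addr0.
split; rewrite ?coefC ?mulr0n ?subr0 //=.
  by case=> [|i]; rewrite coefC /= ?vge0 // mulr0n subr0 vgeE.
by case=> [|i]; rewrite // coefC vgt0.
Qed.

Lemma germ_XsubC c : germ ('X - c%:P) 0 (delta c).
Proof.
exists c => c' cc'; have [nz vc] := deltaB cc'.
rewrite /taylor comp_polyB comp_polyX comp_polyC -addrA -polyCB mulr0n addr0.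
split; rewrite ?coefD ?coefX ?coefC ?mulr0n ?subr0 ?add0r //=.
  case=> [|[|i]]; rewrite coefD coefX coefC /= ?add0r ?addr0 ?vge0 //.
    by rewrite mulr0n subr0 vgeE ?vc.
  by rewrite vgeE ?oner_neq0 // vfun1 mulr1n og_leBlDr add0r ltW.
case=> [|[|i]] // _; rewrite coefD coefX coefC /= ?add0r ?addr0 ?vgt0 //.
by rewrite vgtE ?oner_neq0 // vfun1 mulr1n og_ltBlDr add0r.
Qed.

Lemma germ_leq_size f n m : germ f n m -> (n < size f)%N.
Proof.
move=> h; have [c [fn _ _ _]] := eventually_ex h.
rewrite ltnNge; apply: contraNN fn => fs; apply/eqP.
have /leq_sizeP -> // : (size (taylor c f) <= n)%N.
by rewrite size_comp_poly2 ?size_XaddC.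
Qed.

End Germs.

(** * Polynomials of degree less than p *)

Section SmallDegree.
Variables (K : fieldType) (G : orderedGroupType) (v : valuation K G).
Variable delta : K -> G.
Hypothesis deltaB : forall c c', delta c < delta c' ->
  c' - c != 0 /\ v (c' - c) = delta c.
Hypothesis delta_nomax : forall c, exists c', delta c < delta c'.
Implicit Types (f g q P : {poly K}) (m : G).
Local Notation germ := (germ v delta).

Lemma germ_neq0 f n m : germ f n m -> f != 0.
Proof.
by move=> /(germ_leq_size delta_nomax); rewrite -size_poly_eq0 -lt0n; case: size.
Qed.

Lemma germ_value f m : germ f 0 m ->
  eventually delta (fun c => f.[c] != 0 /\ v f.[c] = m).
Proof.
apply: eventually_imp => c [f0 vf0 _ _].
by rewrite -taylor_coef0; split; rewrite // vf0 !mulr0n addr0 subr0.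
Qed.

(** The root of a linear polynomial is an element c of K, and all better
    approximations c' are at the same distance delta c from it. *)
Lemma germ_linear q n m : size q = 2 -> germ q n m -> n = 0%N.
Proof.
move=> sq gq; have q1 : q`_1 != 0.
  by have := lead_coef_eq0 q; rewrite lead_coefE sq -size_poly_eq0 sq => ->.
have E : q = (q`_1)%:P * ('X - (- (q`_0 / q`_1))%:P).
  apply/polyP => i; rewrite coefCM polyCN opprK coefD coefX coefC.
  case: i => [|[|i]] /=; rewrite ?add0r ?addr0 ?mulr1 ?mulr0 //.
    by rewrite mulrC divfK.
  by have /leq_sizeP -> : (size q <= 2)%N by rewrite sq.
have := germM (germ_polyC v delta q1) (germ_XsubC deltaB (- (q`_0 / q`_1))).
by rewrite -E => /(germ_uniq delta_nomax gq)[].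
Qed.

(** In f = g q + r the index of g q is positive and that of r is 0, so the two
    Gauss valuations have different slopes and [germD] applies: n is 0 or
    n(g) + s, where deg g = deg f - deg q. *)
Lemma germ_index_multiple q s l : germ q s l -> (0 < s)%N ->
  (forall f n m, germ f n m -> (size f < size q)%N -> n = 0%N) ->
  forall f n m, germ f n m ->
  exists2 j, n = (j * s)%N & (j * (size q).-1 < size f)%N.
Proof.
move=> gq s0 min f.
have q0 : q != 0 by exact: germ_neq0 gq.
have sq : (1 < size q)%N by apply: leq_ltn_trans (germ_leq_size delta_nomax gq).
have [N] := ubnP (size f); elim: N f => // N IHN f /ltnSE fN n m gf.
have f0 := germ_neq0 gf.
have [fq|qf] := ltnP (size f) (size q).
  by exists 0%N; rewrite ?mul0n ?size_poly_gt0 // (min _ _ _ gf fq).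
have g0 : f %/ q != 0 by rewrite divpN0.
have [n1 [m1 gg]] := germ_exists deltaB g0.
have sgq : size f = (size (f %/ q)%R + (size q).-1)%N.
  by rewrite size_divp // subnK // (leq_trans (leq_pred _)).
have sg : (size (f %/ q)%R < N)%N.
  by apply: leq_trans fN; rewrite sgq -[X in (X < _)%N]addn0 ltn_add2l -subn1 subn_gt0.
have [j1 e1 s1] := IHN _ sg _ _ gg.
have gfq := germM gg gq.
have res : n = (n1 + s)%N ->
    exists2 j, n = (j * s)%N & (j * (size q).-1 < size f)%N.
  move=> ->; exists j1.+1; first by rewrite e1 mulSn addnC.
  by rewrite sgq mulSn addnC ltn_add2r.
have [r0|r0] := eqVneq (f %% q) 0.
  apply: res; move: gf; rewrite (divp_eq f q) r0 addr0.
  by case/(germ_uniq delta_nomax gfq).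
have [k [l' gr]] := germ_exists deltaB r0.
have ek : k = 0%N by apply: min gr _; rewrite ltn_modp.
rewrite ek in gr.
have k0 : (0 < n1 + s)%N by rewrite addn_gt0 s0 orbT.
have := germD k0 gr gfq; rewrite addrC -divp_eq => -[] g'.
  have [-> _] := germ_uniq delta_nomax gf g'.
  by exists 0%N; rewrite ?mul0n // size_poly_gt0.
by have [e _] := germ_uniq delta_nomax gf g'; apply: res.
Qed.

(** Here s is the index of a polynomial q of least degree having positive
    index. By [germ_index_multiple], p = j s with j deg q <= p, and
    s <= deg q; this forces deg q = s, a divisor of p, and [germ_linear] leaves
    only deg q = p. *)
Lemma germ_small_degree p (P : {poly K}) l : prime p -> size P = p.+1 -> germ P p l ->
  forall f n m, germ f n m -> (size f <= p)%N -> n = 0%N.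
Proof.
move=> pp sP gP.
have [|k [q [s [m [sq s0 gq]]]] min] := @ex_least
   (fun k => exists q s m, [/\ size q = k, (0 < s)%N & germ q s m]).
  by exists p.+1, P, p, l; split; rewrite // prime_gt0.
have min' f n m' : germ f n m' -> (size f < size q)%N -> n = 0%N.
  move=> gf sf; apply/eqP; rewrite -leqn0 leqNgt; apply/negP => n0.
  have : (k <= size f)%N by apply: min; exists f, n, m'.
  by rewrite -sq leqNgt sf.
have [j ej sj] := germ_index_multiple gq s0 min' gP.
have ssq := germ_leq_size delta_nomax gq.
have es : s = (size q).-1.
  have j0 : (0 < j)%N by move: (prime_gt0 pp); rewrite {1}ej muln_gt0 => /andP[].
  apply/eqP; rewrite eqn_leq -ltnS (ltn_predK ssq) ssq /=.
  by rewrite -(leq_pmul2l j0) -ej -ltnS -sP.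
have sp : (s %| p)%N by rewrite {1}ej dvdn_mull.
have := pp => /primeP[_ /(_ _ sp)] /orP[/eqP s1|/eqP s1].
  have sq2 : size q = 2 by rewrite -(ltn_predK ssq) -es s1.
  by have := germ_linear sq2 gq; rewrite s1.
move=> f n m' gf sf; apply: min' gf _.
by rewrite -(ltn_predK ssq) -es s1 ltnS.
Qed.

End SmallDegree.

(** * Frobenius modulo p, residues, extensions of valuations *)

(** The mixed binomial coefficients are divisible by p. *)
Lemma expr_prime_addition (K : fieldType) (G : orderedGroupType)
    (v : valuation K G) p x y : prime p -> vge v 0 x -> vge v 0 y ->
  exists2 z, vge v 0 z & (x + y) ^+ p = x ^+ p + y ^+ p + p%:R * z.
Proof.
move=> pp hx hy; have X n t : vge v 0 t -> vge v 0 (t ^+ n).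
  by move/(vgeX n); rewrite mul0rn.
case: p pp => // p pp.
exists (\sum_(i < p) x ^+ (p - i) * y ^+ i.+1 *+ ('C(p.+1, i.+1) %/ p.+1)).
  by apply: vge_sum => i _; apply: vgeMn; rewrite vge0M ?X.
rewrite exprDn big_ord_recl big_ord_recr /= /bump /= !add1n.
rewrite subn0 bin0 expr0 mulr1 mulr1n subnn binn expr0 mul1r mulr1n.
rewrite -[RHS]addrA; congr (_ + _); rewrite [RHS]addrC; congr (_ + _).
rewrite mulr_sumr; apply: eq_bigr => i _.
rewrite add1n subSS mulr_natl -mulrnA divnK //.
by apply: prime_dvd_bin => //; rewrite /= ltnS.
Qed.

Section Residue.
Variables (K : fieldType) (G : orderedGroupType) (v : valuation K G).
Local Open Scope quotient_scope.

Lemma residue_val (y : valringType v) :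
  residue v (val y) = \pi_(residueField v) y.
Proof. by rewrite /residue valKd. Qed.

Lemma residueP x y : x \in valring v -> y \in valring v ->
  reflect (residue v x = residue v y) (vgt v 0 (x - y)).
Proof.
move=> hx hy.
have -> : vgt v 0 (x - y) =
    ((insubd (0 : valringType v) x - insubd 0 y) \in max_ideal (v := v)).
  by rewrite unfold_in /= !insubdK.
by rewrite Quotient.idealrBE; apply: eqP.
Qed.

End Residue.

Section Extends.
Variables (K : fieldType) (G : orderedGroupType) (v : valuation K G).
Variables (L : fieldExtType K) (H : orderedGroupType) (w : valuation L H).
Variable phi : {additive G -> H}.
Hypothesis w_ext : extends v w phi.
Implicit Types m : G.

Lemma extends_lt (g h : G) : (phi g < phi h) = (g < h).
Proof. by case: w_ext => mono _; rewrite !og_ltNge mono. Qed.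

Lemma extends_vge m c : vge v m c -> vge w (phi m) c%:A.
Proof.
case: w_ext => mono wE; have [->|c0] := eqVneq c 0; first by rewrite scale0r !vge0.
by rewrite !vgeE ?scaler_eq0 ?oner_eq0 ?orbF // wE // mono.
Qed.

Lemma extends_vgt m c : vgt v m c -> vgt w (phi m) c%:A.
Proof.
case: w_ext => mono wE; have [->|c0] := eqVneq c 0; first by rewrite scale0r !vgt0.
by rewrite !vgtE ?scaler_eq0 ?oner_eq0 ?orbF // wE // extends_lt.
Qed.

End Extends.

(** * The valuation of a Kummer extension *)

Lemma factor_Xn_sub_expn (F : fieldType) n (z x : F) :
  n.-primitive_root z -> x != 0 ->
  let rs := [seq z ^+ i * x | i <- iota 0 n] in
  'X^n - (x ^+ n)%:P = \prod_(r <- rs) ('X - r%:P) /\ uniq rs.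
Proof.
move=> prim x0 rs; have n0 := prim_order_gt0 prim.
have U : uniq rs.
  rewrite map_inj_in_uniq ?iota_uniq // => i j; rewrite !mem_iota /= => hi hj.
  move/(mulIf x0)/eqP; rewrite (eq_prim_root_expr prim) !modn_small //.
  by move/eqP.
split=> //; rewrite [LHS](@all_roots_prod_XsubC _ _ rs).
- by rewrite (monicP (monicXnsubC _ n0)) scale1r.
- by rewrite size_XnsubC // size_map size_iota.
- apply/allP => _ /mapP[i _ ->]; rewrite /root !hornerE.
  by rewrite exprMn exprAC (prim_expr_order prim) expr1n mul1r subrr.
- by rewrite uniq_rootsE.
Qed.

Section KummerValuation.
Variables (K : fieldType) (G : orderedGroupType) (v : valuation K G).
Variable delta : K -> G.
Hypothesis deltaB : forall c c', delta c < delta c' ->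
  c' - c != 0 /\ v (c' - c) = delta c.
Hypothesis delta_nomax : forall c, exists c', delta c < delta c'.
Hypothesis delta1 : 0 < delta 1.
Variables (p : nat) (b : K).
Hypothesis pp : prime p.
Hypothesis pK : p%:R != 0 :> K.
Hypothesis delta_p : forall c, delta c *+ p < v p%:R.
Hypothesis vb : vge v 0 b.
(** A p-th root of b is at least as close to c as [delta] says. *)
Hypothesis near_root : forall c, delta 1 < delta c ->
  vge v (delta c *+ p) (c ^+ p - b).
Implicit Types (f g q : {poly K}) (m : G).
Local Notation germ := (germ v delta).
Local Notation P := ('X^p - b%:P).

Lemma vge0_near c : delta 1 < delta c -> vge v 0 c.
Proof.
move=> h; have [nz vc] := deltaB h.
by rewrite -(subrK 1 c) vgeD ?vge1 // vgeE // vc ltW.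
Qed.

(** Every p-th root of b lies in the ball of radius delta c around c: the
    leading coefficient 1 and the constant coefficient c ^+ p - b bound the
    Newton polygon, and the other coefficients are divisible by p, whose value
    exceeds delta c *+ p. *)
Lemma germ_Kummer : germ P p 0.
Proof.
exists 1 => c dc; rewrite add0r.
have dc0 : 0 < delta c := lt_trans delta1 dc.
have coefE i : (taylor c P)`_i = c ^+ (p - i) *+ 'C(p, i) - b *+ (i == 0%N).
  rewrite /taylor comp_polyB comp_polyC comp_Xn_poly coefD coefN coefC.
  by rewrite coef_XaddC_exp; case: i.
have p0 := prime_gt0 pp.
have lead : (taylor c P)`_p = 1.
  by rewrite coefE subnn binn expr0 mulr1n eqn0Ngt p0 subr0.
have big i : (p < i)%N -> (taylor c P)`_i = 0.
  by move=> pi; rewrite coefE bin_small // mulr0n eqn0Ngt (leq_trans _ pi) // subr0.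
split; rewrite ?lead ?oner_neq0 ?vfun1 ?subrr //; last first.
  by move=> i /big ->; rewrite vgt0.
move=> i; have [ip|/big->|->] := ltngtP i p; last 2 first.
- by rewrite vge0.
- by rewrite lead subrr vge1.
case: i ip => [|i] ip.
  by rewrite coefE /= subn0 bin0 !mulr1n mulr0n subr0 near_root.
rewrite coefE mulr0n subr0.
have /dvdnP[k ->] : (p %| 'C(p, i.+1))%N by rewrite prime_dvd_bin.
rewrite mulrnA -mulr_natl; apply: (@vge_le _ _ _ _ (delta c *+ p)).
  by rewrite og_leBlDr -{1}[delta c *+ p]addr0 og_leD2l -(mul0rn _ i.+1) og_leMn // ltW.
rewrite mulrC; apply: vge0M.
  by apply: vgeMn; move/(vgeX (p - i.+1)): (vge0_near dc); rewrite mul0rn.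
by rewrite vgeE // ltW.
Qed.

Lemma size_Kummer : size P = p.+1.
Proof. by rewrite size_XnsubC // prime_gt0. Qed.

Lemma germ_lt_degree f : f != 0 -> (size f <= p)%N -> exists m, germ f 0 m.
Proof.
move=> f0 sf; have [n [m gf]] := germ_exists deltaB f0; exists m.
by rewrite -(germ_small_degree deltaB delta_nomax pp size_Kummer germ_Kummer gf).
Qed.

(** Proper factors would both have index 0, by [germ_lt_degree], while the
    indices add up to p. *)
Lemma irreducible_Kummer : irreducible_poly P.
Proof.
have p0 := prime_gt0 pp.
have P0 : P != 0 by rewrite -size_poly_eq0 size_Kummer.
split; first by rewrite size_Kummer ltnS.
move=> q sq qP; have q0 := dvdpN0 qP P0.
have := dvdp_leq P0 qP; rewrite leq_eqVlt => /orP[e|]; first by rewrite -dvdp_size_eqp.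
rewrite size_Kummer ltnS => sqp; exfalso.
have eP := divpK qP; set g := P %/ q in eP.
have g0 : g != 0 by apply: contraNneq P0 => g0; rewrite -eP g0 mul0r.
have sg : (size g <= p)%N.
  rewrite /g size_divp // size_Kummer leq_subLR.
  have : (0 < (size q).-1)%N.
    by have := size_poly_eq0 q; rewrite (negPf q0); case: (size q) sq => [|[|]].
  by move=> h; rewrite -addn1 addnC leq_add2r.
have [m gq] := germ_lt_degree q0 sqp; have [m' gg] := germ_lt_degree g0 sg.
have := germM gg gq; rewrite eP => /(germ_uniq delta_nomax germ_Kummer)[e _].
by move: p0; rewrite e.
Qed.

Section Extension.
Variables (L : fieldExtType K) (eta : L).
Hypothesis eta_p : eta ^+ p = b%:A.
Hypothesis eta_gen : <<1; eta>>%VS = fullv.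

Local Notation ev := (horner_alg eta).

Lemma ev_X : ev 'X = eta. Proof. exact: horner_algX. Qed.
Lemma ev_C c : ev c%:P = c%:A. Proof. exact: horner_algC. Qed.

Lemma ev_XsubC c : ev ('X - c%:P) = eta - c%:A.
Proof. by rewrite rmorphB /= ev_X ev_C. Qed.

Lemma ev_Kummer : ev P = 0.
Proof. by rewrite rmorphB rmorphXn /= ev_X ev_C eta_p subrr. Qed.

Lemma ev_modp f : ev (f %% P) = ev f.
Proof. by rewrite [in RHS](divp_eq f P) rmorphD rmorphM /= ev_Kummer mulr0 add0r. Qed.

Lemma Kummer_neq0 : P != 0.
Proof. by rewrite -size_poly_eq0 size_Kummer. Qed.

Lemma size_modp_Kummer f : (size (f %% P)%R <= p)%N.
Proof. by rewrite -ltnS -size_Kummer ltn_modp Kummer_neq0. Qed.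

Lemma ev_surj x : exists f, (size f <= p)%N && (ev f == x).
Proof.
have : x \in <<1; eta>>%VS by rewrite eta_gen memvf.
case/Fadjoin_polyP => _ /polyOver1P[f ->] ->.
exists (f %% P); rewrite size_modp_Kummer ev_modp /=.
by rewrite /horner_alg /horner_morph.
Qed.

Lemma ev_neq0 f : f != 0 -> (size f <= p)%N -> ev f != 0.
Proof.
move=> f0 sf; have irr := irreducible_Kummer.
have cop : coprimep P f.
  rewrite irreducible_poly_coprime //; apply: contraL sf => /(dvdp_leq f0).
  by rewrite size_Kummer -ltnNge.
have /Bezout_coprimepP[[u1 u2] /=] := cop.
rewrite -size_poly_eq1 => /size_poly1P[c c0 ec]; apply/eqP => e.
have := congr1 ev ec; rewrite rmorphD !rmorphM /= ev_Kummer e !mulr0 addr0 ev_C.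
by move/esym/eqP; rewrite scaler_eq0 oner_eq0 orbF (negPf c0).
Qed.

Lemma ev_inj f g : (size f <= p)%N -> (size g <= p)%N -> ev f = ev g -> f = g.
Proof.
move=> sf sg e; apply/eqP; rewrite -subr_eq0; apply: contraT => fg0.
suff /(ev_neq0 fg0) : (size (f - g)%R <= p)%N by rewrite rmorphB /= e subrr eqxx.
by apply: leq_trans (size_polyD _ _) _; rewrite size_polyN geq_max sf.
Qed.

Definition rep x : {poly K} := xchoose (ev_surj x).

Lemma size_rep x : (size (rep x) <= p)%N.
Proof. by case/andP: (xchooseP (ev_surj x)). Qed.

Lemma ev_rep x : ev (rep x) = x.
Proof. by case/andP: (xchooseP (ev_surj x)) => _ /eqP. Qed.

Lemma rep_neq0 x : x != 0 -> rep x != 0.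
Proof. by apply: contraNneq => e; rewrite -(ev_rep x) e rmorph0. Qed.

(** The value of f.[eta], for f of degree less than p, is the final value of
    v (f c). It is chosen by [epsilon] from the germ of f. *)
Definition ext_fun (x : L) : G := epsilon (inhabits 0) (fun m => germ (rep x) 0 m).

Lemma germ_rep x : x != 0 -> germ (rep x) 0 (ext_fun x).
Proof.
move=> /rep_neq0 x0; apply: epsilon_spec.
exact: germ_lt_degree x0 (size_rep x).
Qed.

Lemma ext_funE f m : (size f <= p)%N -> germ f 0 m -> ext_fun (ev f) = m.
Proof.
move=> sf gf; have f0 := germ_neq0 delta_nomax gf.
have := germ_rep (ev_neq0 f0 sf).
rewrite (ev_inj (size_rep _) sf (ev_rep _)).
by case/(germ_uniq delta_nomax gf).
Qed.

(** The product of the representatives f and g has index 0. Its quotient by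
    'X^p - b contributes a term of positive index, which therefore never
    dominates: the remainder has the same final value as f g. *)
Lemma ext_funM x y : x != 0 -> y != 0 ->
  ext_fun (x * y) = ext_fun x + ext_fun y.
Proof.
move=> x0 y0; set f := rep x * rep y.
have gf : germ f 0 (ext_fun x + ext_fun y) := germM (germ_rep x0) (germ_rep y0).
have evr : ev (f %% P) = x * y by rewrite ev_modp rmorphM /= !ev_rep.
have r0 : f %% P != 0.
  by apply: contraNneq (mulf_neq0 x0 y0) => e; rewrite -evr e rmorph0.
rewrite -evr.
have [m gr] := germ_lt_degree r0 (size_modp_Kummer f).
rewrite (ext_funE (size_modp_Kummer f) gr).
have [q0|q0] := eqVneq (f %/ P) 0.
  move: gf; rewrite (divp_eq f P) q0 mul0r add0r.
  by case/(germ_uniq delta_nomax gr).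
have [k [l gq]] := germ_exists deltaB q0.
have kp : (0 < k + p)%N by rewrite addn_gt0 (prime_gt0 pp) orbT.
have := germD kp gr (germM gq germ_Kummer); rewrite addrC -divp_eq => -[] gf'.
  by have [] := germ_uniq delta_nomax gf' gf.
by have [e _] := germ_uniq delta_nomax gf gf'; rewrite -e in kp.
Qed.

Lemma ext_funD x y : x != 0 -> y != 0 -> x + y != 0 ->
  Order.min (ext_fun x) (ext_fun y) <= ext_fun (x + y).
Proof.
move=> x0 y0 xy0.
have gxy : germ (rep x + rep y) 0 (ext_fun (x + y)).
  rewrite -(_ : rep (x + y) = rep x + rep y); first exact: germ_rep.
  apply: ev_inj; rewrite ?rmorphD /= ?ev_rep ?size_rep //.
  by apply: leq_trans (size_polyD _ _) _; rewrite geq_max !size_rep.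
have [c [[fx vx] [[fy vy] [fxy vxy]]]] := eventually_ex delta_nomax
  (eventually_and (germ_value (germ_rep x0))
  (eventually_and (germ_value (germ_rep y0)) (germ_value gxy))).
by rewrite -vx -vy -vxy; rewrite hornerD in fxy *; apply: vfunD.
Qed.

Lemma ext_fun_alg c : c != 0 -> ext_fun c%:A = v c.
Proof.
move=> c0; rewrite -ev_C; apply: ext_funE (germ_polyC v delta c0).
by rewrite size_polyC c0 prime_gt0.
Qed.

Lemma ext_fun_XsubC c : ext_fun (eta - c%:A) = delta c.
Proof.
rewrite -ev_XsubC; apply: ext_funE (germ_XsubC deltaB c).
by rewrite size_XsubC prime_gt1.
Qed.

Lemma ext_fun_onto m : exists2 x, x != 0 & ext_fun x = m.
Proof.
have [x x0 vx] := vfun_onto v m; exists x%:A; last by rewrite ext_fun_alg.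
by rewrite scaler_eq0 oner_eq0 orbF.
Qed.

Definition Kummer_valuation : valuation L G :=
  Valuation ext_funM ext_funD ext_fun_onto.

Lemma eta_notin1 : eta \notin 1%VS.
Proof.
apply/negP => /vlineP[c e].
have : ev ('X - c%:P) != 0.
  by rewrite ev_neq0 ?polyXsubC_eq0 // size_XsubC prime_gt1.
by rewrite ev_XsubC e subrr eqxx.
Qed.

Section Approximation.
Variables (H : orderedGroupType) (w : valuation L H) (phi : {additive G -> H}).
Hypothesis w_ext : extends v w phi.

(** Modulo p, (eta - c) ^+ p is b - c ^+ p, whatever the extension of v. *)
Lemma extends_vge_root c : delta 1 < delta c ->
  vge w (phi (delta c)) (eta - c%:A).
Proof.
move=> dc; have p0 := prime_gt0 pp.
have eta0 : vge w 0 eta.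
  have [->|e0] := eqVneq eta 0; first exact: vge0.
  rewrite vgeE // -(og_lepMn _ _ p0) mul0rn -vfunX // -vgeE ?expf_neq0 //.
  by rewrite eta_p -(raddf0 phi); apply: (extends_vge w_ext).
have c0 : vge w 0 c%:A.
  by rewrite -(raddf0 phi); apply: (extends_vge w_ext); apply: vge0_near.
have [z z0] := expr_prime_addition pp (vgeB eta0 c0) c0.
rewrite subrK eta_p => e.
have {e} e : (eta - c%:A) ^+ p = - (c ^+ p - b)%:A - p%:R * z.
  have -> : (c ^+ p - b)%:A = c%:A ^+ p - b%:A :> L.
    by rewrite scalerBl -(rmorphXn (in_alg L)).
  by rewrite opprB e [_ + c%:A ^+ p + _]addrAC !addrK.
have : vge w (phi (delta c) *+ p) ((eta - c%:A) ^+ p).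
  rewrite e -raddfMn; apply: vgeB.
    by rewrite vgeN; apply: (extends_vge w_ext); apply: near_root.
  rewrite -[X in vge _ X]addr0; apply: vgeM => //.
  rewrite -[p%:R](rmorph_nat (in_alg L)); apply: (extends_vge w_ext).
  by rewrite vgeE // ltW.
have [->|ec] := eqVneq (eta - c%:A) 0; first by rewrite vge0.
by rewrite !vgeE ?expf_neq0 // vfunX // og_lepMn.
Qed.

(** In the Taylor expansion of f.[eta] at c, the terms of positive degree are
    strictly smaller than the constant one as soon as n(f) = 0; this
    rests on [extends_vge_root], hence holds for every extension w of v. *)
Lemma ev_approximation f m : germ f 0 m ->
  eventually delta (fun c => vgt w (phi m) (ev f - f.[c]%:A)).
Proof.
move=> gf; apply: eventually_imp (eventually_and (eventually_gt delta 1) gf) => c.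
rewrite mulr0n addr0 => -[dc [_ _ _ gt]].
have ef : ev f = \sum_(i < size (taylor c f)) (taylor c f)`_i *: (eta - c%:A) ^+ i.
  rewrite -{1}(comp_polyXaddC_K f c) -/(taylor c f) comp_polyE rmorph_sum.
  apply: eq_bigr => i _.
  by rewrite -mul_polyC rmorphM rmorphXn /= ev_C ev_XsubC mulr_algl.
have s0 : (0 < size (taylor c f))%N.
  by rewrite size_poly_gt0 taylor_neq0 // (germ_neq0 delta_nomax gf).
rewrite ef (bigD1 (Ordinal s0)) //= expr0 taylor_coef0 addrC addrK.
apply: vgt_sum => i i0; rewrite -[X in vgt _ _ X]mulr_algl.
rewrite -[phi m](subrK (phi (delta c) *+ i)) -raddfMn -raddfB.
apply: vgtMl; last by rewrite raddfMn; apply: vgeX; apply: extends_vge_root.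
by apply: (extends_vgt w_ext); apply: gt; rewrite lt0n.
Qed.

Lemma extends_Kummer x : x != 0 -> w x = phi (Kummer_valuation x).
Proof.
move=> x0; have gx := germ_rep x0.
have [c [near [fc vc]]] := eventually_ex delta_nomax
  (eventually_and (ev_approximation gx) (germ_value gx)).
rewrite ev_rep in near; have [_ wE] := w_ext.
have fc0 : (rep x).[c]%:A != 0 :> L by rewrite scaler_eq0 oner_eq0 orbF.
have wfc : w (rep x).[c]%:A = phi (Kummer_valuation x) by rewrite wE // vc.
rewrite -[in LHS](subrK (rep x).[c]%:A x) addrC -wfc.
by apply: (vfunDl fc0 _).2; rewrite wfc.
Qed.

End Approximation.

Lemma Kummer_extends : extends v Kummer_valuation idfun.
Proof. by split=> // c c0; apply: ext_fun_alg. Qed.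

Lemma Kummer_immediate : immediate v Kummer_valuation idfun.
Proof.
split; first exact: Kummer_extends; first by move=> h; exists h.
elim/quotW => y; rewrite -residue_val; set x := val y.
have x_ge0 : x \in valring Kummer_valuation := valP y.
have [x_gt0|x_le0] := boolP (vgt Kummer_valuation 0 x).
  exists 0; first exact: vge0.
  by apply/residueP; rewrite ?scale0r ?sub0r ?vgtN //; apply: vge0.
have x0 : x != 0 by apply: contraNneq x_le0 => ->; apply: vgt0.
have vx : Kummer_valuation x = 0.
  apply: le_anti; rewrite og_leNgt -vgtE // x_le0 /=.
  by move: x_ge0; rewrite vge_valring vgeE.
have gx := germ_rep x0.
have [c [near [fc vc]]] := eventually_ex delta_nomax
  (eventually_and (ev_approximation Kummer_extends gx) (germ_value gx)).
rewrite ev_rep [ext_fun x]vx /= in near vc.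
have v_fc : (rep x).[c] \in valring v by rewrite vge_valring vgeE // vc.
exists (rep x).[c] => //; apply/residueP => //.
  by rewrite vge_valring; apply: (extends_vge Kummer_extends v_fc).
by rewrite -opprB vgtN.
Qed.

Lemma Kummer_unique : unique_extension v Kummer_valuation.
Proof.
move=> H w phi w_ext x; rewrite !vge_valring.
have [->|x0] := eqVneq x 0; first by rewrite !vge0.
rewrite !vgeE // (extends_Kummer w_ext) //.
by case: w_ext => mono _; rewrite -(raddf0 phi) mono.
Qed.

End Extension.
(** A field with a root of 'X^p - b contains all of them, since zeta is in K;
    this makes it a splitting field. *)
Lemma Kummer_splitting_field (zeta : K) : b != 0 -> p.-primitive_root zeta ->
  exists (L : splittingFieldType K) (eta : L),
    [/\ galois 1 {:L}, \dim {:L} = p, eta ^+ p = b%:A & <<1; eta>>%VS = {:L}%VS].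
Proof.
move=> b0 prim; have p0 := prime_gt0 pp.
have [L dimL [eta rt gen]] := irredp_FAdjoin irreducible_Kummer.
have etap : eta ^+ p = b%:A.
  move: rt; rewrite rmorphB /= map_polyXn map_polyC /root !hornerE.
  by rewrite subr_eq0 => /eqP.
have eta0 : eta != 0.
  have : eta ^+ p != 0 by rewrite etap scaler_eq0 oner_eq0 orbF.
  by apply: contraNneq => ->; rewrite expr0n eqn0Ngt p0.
have primL : p.-primitive_root (zeta%:A : L) by rewrite -in_algE fmorph_primitive_root.
have [fac U] := factor_Xn_sub_expn primL eta0.
set rs := [seq _ | _ <- _] in fac U.
have Qover : 'X^p - (eta ^+ p)%:P \is a polyOver (1%VS : {vspace L}).
  by rewrite etap rpredB ?rpredX ?polyOverX // polyOverC rpredZ // mem1v.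
have split1 : splittingFieldFor 1 ('X^p - (eta ^+ p)%:P) {:L}.
  exists rs; first by rewrite fac eqpxx.
  apply/eqP; rewrite eqEsubv subvf -gen; apply/FadjoinP; split.
    exact: sub1v.
  apply: seqv_sub_adjoin; apply/mapP; exists 0%N; rewrite ?mem_iota //.
  by rewrite expr0 mul1r.
have ax : splitting_field_axiom L by exists ('X^p - (eta ^+ p)%:P).
pose LS : splittingFieldType K := HB.pack L (FieldExt_isSplittingField.Build K L ax).
have gal : galois 1 {:LS}.
  apply/splitting_galoisField; exists ('X^p - (eta ^+ p)%:P); split=> //.
  by rewrite fac separable_prod_XsubC.
by exists LS, eta; split; rewrite // dimL size_Kummer.
Qed.

Lemma Kummer_extension_exists (zeta : K) (beta : divHull G) :
  b != 0 -> p.-primitive_root zeta ->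
  (forall c, delta c *+ dh_den beta <= dh_num beta) ->
  dh_lt beta (dh_div (v p%:R) p) ->
  exists L : splittingFieldType K, super_dependent_Kummer_ext v p L /\
    exists eta : L, eta ^+ p = b%:A /\ eta \notin 1%VS.
Proof.
move=> b0 prim delta_le beta_lt; have p0 := prime_gt0 pp.
have [L [eta [gal dimL etap gen]]] := Kummer_splitting_field b0 prim.
exists L; split; last by exists eta; split; rewrite // (eta_notin1 etap).
exists G, (Kummer_valuation etap gen), idfun.
have gen_eta : Kummer_generator p eta.
  by split; rewrite ?(eta_notin1 etap) // etap rpredZ // mem1v.
have gal_defect : Galois_defect v p (Kummer_valuation etap gen) idfun.
  split=> //; first exact: Kummer_immediate.
  exact: Kummer_unique.
split; first by split=> //; exists eta.
exists eta; split=> //.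
  rewrite /one_unit vgt_valideal -[1]scale1r.
  by apply/orP; right; rewrite /= ext_fun_XsubC.
exists beta; split=> // c; rewrite /dh_le /= ext_fun_XsubC /dh_den /= mulr1n.
exact: delta_le.
Qed.

End KummerValuation.

(** * Kummer theory *)

Section KummerTheory.
Variables (K : fieldType) (p : nat) (zeta : K).
Hypothesis pp : prime p.
Hypothesis prim : p.-primitive_root zeta.

(** The quotient of two conjugate p-th roots is a p-th root of unity. *)
Lemma Kummer_conjugate (L : splittingFieldType K) (s : gal_of {:L}) (x : L) a :
  x != 0 -> x ^+ p = a%:A -> exists i, s x = (zeta ^+ i)%:A * x.
Proof.
move=> x0 xp.
have primL : p.-primitive_root (zeta%:A : L) by rewrite -in_algE fmorph_primitive_root.
have /(prim_rootP primL)[i e] : (s x / x) ^+ p = 1.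
  rewrite expr_div_n -rmorphXn /= xp linearZ /= rmorph1 divff //.
  by rewrite -xp expf_neq0.
by exists i; rewrite -[s x](divfK x0) e -(rmorphXn (in_alg L)).
Qed.

(** The Galois group has prime order, so it is generated by any s moving x.
    As s multiplies x and y by powers of zeta, and its action on x is
    nontrivial, some y / x ^+ k is fixed by s, hence lies in K. *)
Lemma Kummer_class (L : splittingFieldType K) (x y : L) a b :
  galois 1 {:L} -> \dim {:L} = p ->
  x ^+ p = a%:A -> x \notin 1%VS -> y ^+ p = b%:A -> y != 0 ->
  exists k z, b = a ^+ k * z ^+ p.
Proof.
move=> gal dimL xp x1 yp y0.
have x0 : x != 0 by apply: contraNneq x1 => ->; rewrite mem0v.
have cardG : #|'Gal({:L} / 1)%g| = p.
  by rewrite -(galois_dim gal) dimv1 divn1.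
have fixG : fixedField 'Gal({:L} / 1)%g = 1%VS := galois_fixedField gal.
have [s sG sx] : exists2 s, s \in 'Gal({:L} / 1)%g & s x != x.
  apply/exists_inP; apply: contraNT x1; rewrite negb_exists_in => /forall_inP h.
  rewrite -fixG; apply/fixedFieldP; first exact: memvf.
  by move=> s /h; rewrite negbK => /eqP.
have genG : 'Gal({:L} / 1)%g = <[s]>%g.
  apply/esym/eqP; rewrite eqEcard cycle_subG sG cardG.
  have : (#[s]%g %| p)%N by rewrite -cardG cardSg ?cycle_subG.
  have s1 : #[s]%g != 1%N.
    by rewrite order_eq1; apply: contraNneq sx => ->; rewrite gal_id.
  by case/primeP: pp => _ h /h /=; rewrite (negPf s1) -orderE => /eqP ->.
have [i si] := Kummer_conjugate s x0 xp; have [j sj] := Kummer_conjugate s y0 yp.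
have primi : p.-primitive_root (zeta ^+ i).
  rewrite (prim_root_exp_coprime _ prim) coprime_sym prime_coprime //.
  apply: contra sx => /dvdnP[q ei]; rewrite si ei mulnC exprM.
  by rewrite (prim_expr_order prim) expr1n scale1r mul1r.
have /(prim_rootP primi)[k ek] : (zeta ^+ j) ^+ p = 1.
  by rewrite exprAC (prim_expr_order prim) expr1n.
have zj0 : (zeta ^+ j)%:A != 0 :> L.
  rewrite scaler_eq0 oner_eq0 orbF expf_neq0 //.
  apply: contraNneq (oner_neq0 K) => z0.
  by rewrite -(prim_expr_order prim) z0 expr0n eqn0Ngt prime_gt0.
have st : s (y / x ^+ k) = y / x ^+ k.
  rewrite rmorphM fmorphV rmorphXn /= si sj exprMn -(rmorphXn (in_alg L)) /= -ek.
  by rewrite -mulf_div divff // mul1r.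
have : y / x ^+ k \in fixedField 'Gal({:L} / 1)%g.
  apply/fixedFieldP; first exact: memvf.
  rewrite genG => _ /cycleP[m ->]; elim: m => [|m IHm]; first by rewrite gal_id.
  by rewrite expgSr galM ?memvf // IHm.
rewrite fixG => /vlineP[z ez]; exists k, z.
have xk0 : x ^+ k != 0 by rewrite expf_neq0.
have ey : y = z%:A * x ^+ k by rewrite -ez divfK.
apply: (fmorph_inj (in_alg L)); rewrite rmorphM !rmorphXn /=.
by rewrite -yp ey exprMn exprAC xp mulrC.
Qed.

Lemma Kummer_isomorphic (L L' : splittingFieldType K) (x : L) (y : L') a b :
  K_isomorphic L L' -> galois 1 {:L'} -> \dim {:L'} = p ->
  x ^+ p = b%:A -> x != 0 -> y ^+ p = a%:A -> y \notin 1%VS ->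
  exists k z, b = a ^+ k * z ^+ p.
Proof.
move=> [f _] gal dimL xp x0 yp y1.
apply: (Kummer_class gal dimL yp y1 (y := f x)); last by rewrite fmorph_eq0.
by rewrite -rmorphXn /= xp rmorph_alg.
Qed.

End KummerTheory.

(** * Infinitely many classes of radicands *)

Section Radicands.
Variables (K : fieldType) (G : orderedGroupType) (v : valuation K G).
Variable delta : K -> G.
Hypothesis deltaB : forall c c', delta c < delta c' ->
  c' - c != 0 /\ v (c' - c) = delta c.
Hypothesis delta_nomax : forall c, exists c', delta c < delta c'.
Hypothesis delta1 : 0 < delta 1.
Variables (p : nat) (a : K).
Hypothesis pp : prime p.
Hypothesis pK : p%:R != 0 :> K.
Hypothesis delta_root : forall y, vge v 0 y ->
  a - y ^+ p != 0 /\ v (a - y ^+ p) = delta y *+ p.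
Variable beta : divHull G.
Hypothesis delta_le : forall c, delta c *+ dh_den beta <= dh_num beta.
Hypothesis beta_lt : dh_lt beta (dh_div (v p%:R) p).
Hypothesis arch : rank1 G.

Implicit Types (g h m : G).

Let p0 : (0 < p)%N := prime_gt0 pp.

Lemma beta_lt_cross : dh_num beta *+ p < v p%:R *+ dh_den beta.
Proof. by move: beta_lt; rewrite /dh_lt /dh_div {1}/dh_den /= prednK. Qed.

Lemma delta_lt_vp c : delta c *+ p < v p%:R.
Proof.
rewrite -(@og_ltpMn _ (dh_den beta)) //; apply: le_lt_trans beta_lt_cross.
by rewrite -mulrnA mulnC mulrnA og_leMn.
Qed.

(** Otherwise delta could be increased by g again and again, and would exceed
    v p since G is archimedean. *)
Lemma delta_cofinal g : 0 < g -> exists c, forall c', delta c' < delta c + g.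
Proof.
move=> g0; apply: NNPP => no.
have step c : exists c', delta c + g <= delta c'.
  apply: NNPP => h; apply: no; exists c => c'.
  by rewrite og_ltNge; apply/negP => h'; apply: h; exists c'.
have far n : exists c, g *+ n < delta c.
  elim: n => [|n [c IHc]]; first by exists 1.
  have [c' hc'] := step c; exists c'; apply: lt_le_trans hc'.
  by rewrite mulrSr og_ltD2r.
have [n hn] := arch.2 g (v p%:R) g0; have [c hc] := far n.
have dc0 : 0 <= delta c.
  by apply: ltW; apply: le_lt_trans hc; rewrite -(mul0rn _ n) og_leMn // ltW.
have dc : delta c < v p%:R.
  apply: le_lt_trans (delta_lt_vp c).
  by rewrite -{1}[delta c]mulr1n; apply: og_leMn2.
by have := lt_trans dc (le_lt_trans hn hc); rewrite ltxx.
Qed.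

(** G is not discrete: by [delta_cofinal] two consecutive increments of delta
    fit below g. *)
Lemma half_exists g : 0 < g -> exists2 h, 0 < h & h *+ 2 <= g.
Proof.
move=> g0; have [c hc] := delta_cofinal g0.
have [c1 h1] := delta_nomax c; have [c2 h2] := delta_nomax c1.
have hx : 0 < delta c1 - delta c by rewrite og_subr_gt0.
have hy : 0 < delta c2 - delta c1 by rewrite og_subr_gt0.
have hxy : (delta c1 - delta c) + (delta c2 - delta c1) <= g.
  by rewrite addrC addrA subrK og_leBlDr addrC ltW.
case/orP: (og_total (delta c1 - delta c) (delta c2 - delta c1)) => h.
  exists (delta c1 - delta c) => //; apply: le_trans hxy.
  by rewrite mulr2n og_leD2l.
exists (delta c2 - delta c1) => //; apply: le_trans hxy.
by rewrite mulr2n og_leD2r.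
Qed.

Lemma fraction_exists n g : 0 < g -> exists2 h, 0 < h & h *+ n <= g.
Proof.
elim: n g => [|n IHn] g g0; first by exists g => //; rewrite mulr0n ltW.
have [h h0 hg] := half_exists g0; have [k k0 kh] := IHn h h0.
case/orP: (og_total h k) => hk.
  exists h => //; apply: le_trans hg; rewrite mulrS mulr2n og_leD2l.
  by apply: le_trans kh; apply: og_leMn.
exists k => //; apply: le_trans hg; rewrite mulrS mulr2n.
exact: og_leD.
Qed.

(** This replaces a strict comparison of m with the supremum of the
    delta c *+ p, which need not exist in G. *)
Definition above m := exists2 g, 0 < g & forall c, (delta c + g) *+ p <= m.

(** The gap between beta and v p / p only exists in the divisible hull; a
    positive element of G fitting into it is obtained by [fraction_exists]. *)
Lemma above_vp : above (v p%:R).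
Proof.
pose e := v p%:R *+ dh_den beta - dh_num beta *+ p.
have e0 : 0 < e by rewrite og_subr_gt0 beta_lt_cross.
have [g g0 hg] := fraction_exists (p * dh_den beta) e0.
exists g => // c; rewrite -(@og_lepMn _ (dh_den beta)) // -mulrnA mulrnDl.
apply: le_trans (og_leD _ hg) (_ : dh_num beta *+ p + e <= _).
  by rewrite mulnC mulrnA og_leMn.
by rewrite /e addrC subrK.
Qed.

(** The value of u.1 ^+ p * (a - u.2 ^+ p). *)
Definition level (u : K * K) := (v u.1 + delta u.2) *+ p.

(** The pair u = (t, c) prescribes the perturbation t ^+ p (a - c ^+ p) of 1. Its
    value has to stay above all delta c' *+ p, but every t ^+ p (a - c' ^+ p)
    has to stay below m, the value of the perturbations built before. *)
Definition refines m (u : K * K) :=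
  [/\ u.1 != 0, vge v 0 u.2, 0 < v u.1,
      forall c, (v u.1 + delta c) *+ p < m & above (level u)].

(** Take v t = h at most half of the room g below m, and c so close that every
    delta c' is below delta c + k, where k is at most half of h. *)
Lemma refinement_exists m : above m -> exists u, refines m u.
Proof.
move=> [g g0 hg]; have [h h0 hh] := half_exists g0; have [k k0 hk] := half_exists h0.
have [c hc] := delta_cofinal k0; have [t t0 vt] := vfun_onto v h.
have [c1 [cc1 c11]] : exists c1, delta c <= delta c1 /\ delta 1 < delta c1.
  case/orP: (og_total (delta c) (delta 1)) => h1.
    by have [c1 hc1] := delta_nomax 1; exists c1; split; rewrite // (le_trans h1) ?ltW.
  by have [c1 hc1] := delta_nomax c; exists c1; split; [apply: ltW | apply: le_lt_trans hc1].
exists (t, c1); split; rewrite ?vt //=.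
- exact: vge0_near deltaB delta1 _ c11.
- move=> c'; apply: lt_le_trans (hg c'); apply: og_ltMn => //.
  rewrite addrC og_ltD2l; apply: lt_le_trans hh.
  by rewrite mulr2n -{1}[h]addr0 og_ltD2l.
exists k => // c'; rewrite /level vt /=; apply: og_leMn.
apply: (@le_trans _ _ (delta c1 + k + k)).
  rewrite og_leD2r; apply: ltW; apply: lt_le_trans (hc c') _.
  by rewrite og_leD2r.
by rewrite -addrA addrC og_leD2r -mulr2n.
Qed.

(** Elements that are negligible in comparison with all a - y ^+ p. *)
Definition small x := forall c, vgt v (delta c *+ p) x.

Lemma smallD x y : small x -> small y -> small (x + y).
Proof. by move=> hx hy c; apply: vgtD. Qed.

Lemma smallN x : small (- x) <-> small x.
Proof. by split=> h c; have := h c; rewrite vgtN. Qed.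

Lemma smallB x y : small x -> small y -> small (x - y).
Proof. by move=> hx hy; apply: smallD => //; apply/smallN. Qed.

Lemma smallMl x y : vge v 0 x -> small y -> small (x * y).
Proof. by move=> hx hy c; rewrite -[_ *+ p]add0r vgtMr. Qed.

Lemma small_vge_vp x : vge v (v p%:R) x -> small x.
Proof. by move=> hx c; apply: vge_gt hx; apply: delta_lt_vp. Qed.

Lemma small_above m x : above m -> vge v m x -> small x.
Proof.
move=> [g g0 hg] hx c; apply: vge_gt hx; apply: lt_le_trans (hg c).
by apply: og_ltMn => //; rewrite -{1}[delta c]addr0 og_ltD2l.
Qed.

Lemma not_small_root y : vge v 0 y -> ~ small (a - y ^+ p).
Proof.
by move=> /delta_root[nz vy] /(_ y); rewrite vgtE // vy ltxx.
Qed.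

Lemma small_vgt0 x : small x -> vgt v 0 x.
Proof.
move=> hx; apply: vgt_le (hx 1); rewrite -(mul0rn _ p).
by apply: og_leMn; apply: ltW.
Qed.

Lemma smallX x y n : vge v 0 x -> vge v 0 y -> small (x - y) ->
  small (x ^+ n - y ^+ n).
Proof.
move=> hx hy hxy; rewrite subrXX mulrC; apply: smallMl => //.
apply: vge_sum => i _; apply: vge0M.
  by have := vgeX (n.-1 - i) hx; rewrite mul0rn.
by have := vgeX i hy; rewrite mul0rn.
Qed.

Lemma v_a : a != 0 /\ v a = 0.
Proof.
have [nz va] := delta_root (vge1 v); rewrite expr1n in nz va.
have := @vfunDl _ _ v 1 (a - 1) (oner_neq0 K).
rewrite addrCA subrr addr0 vfun1 => h; apply: h.
by rewrite vgtE // va -(mul0rn _ p) og_ltMn.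
Qed.

Lemma v_near_a b : small (b - a) -> b != 0 /\ v b = 0.
Proof.
move=> hb; have [a0 va] := v_a.
by have := @vfunDl _ _ v a (b - a) a0; rewrite addrCA subrr addr0 va; apply; apply: small_vgt0.
Qed.

Lemma vgeV x : x != 0 -> v x = 0 -> vge v 0 x^-1.
Proof. by move=> x0 vx; rewrite vgeE ?invr_eq0 // vfunV // vx oppr0. Qed.

(** Modulo small elements, b and b' are a, so that a is a ^+ k z ^+ p. If k - 1
    were prime to p, a would be a p-th power up to a small element, against
    [not_small_root]. *)
Lemma Kummer_class_near b b' k z :
  small (b - a) -> small (b' - a) -> b' = b ^+ k * z ^+ p ->
  exists2 z', z' != 0 /\ v z' = 0 & b' = b * z' ^+ p.
Proof.
move=> hb hb' e.
have [a0 va] := v_a; have [b0 vb] := v_near_a hb; have [b0' vb'] := v_near_a hb'.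
have z0 : z != 0.
  by apply: contraNneq b0' => z0; rewrite e z0 expr0n eqn0Ngt p0 mulr0.
have vz : v z = 0.
  apply: (og_mulrn_eq0 p0).
  by move: vb'; rewrite e vfunM ?expf_neq0 // !vfunX // vb mul0rn add0r.
(* The exponent k - 1 modulo p, without subtraction in case k = 0. *)
pose l := (k + p.-1)%N.
have l0 : (0 < l)%N by rewrite addn_gt0 -subn1 subn_gt0 prime_gt1 // orbT.
have [/dvdnP[r er]|pl] := boolP (p %| l)%N.
  have r0 : (0 < r)%N by move: l0; rewrite er muln_gt0 => /andP[].
  have ek : k = (r.-1 * p).+1.
    apply: (@addIn p.-1); rewrite -/l er addSnnS prednK //.
    by rewrite -{1}(prednK r0) mulSn addnC.
  exists (b ^+ r.-1 * z); last by rewrite exprMn -exprM mulrA -exprS -ek.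
  by rewrite mulf_neq0 ?expf_neq0 // vfunM ?expf_neq0 // vfunX // vb vz mul0rn addr0.
exfalso; have /eqP gcd1 : coprime l p by rewrite coprime_sym prime_coprime.
have [u w euw _] := egcdnP p l0; rewrite gcd1 addn1 in euw.
have O x : x != 0 -> v x = 0 -> vge v 0 x by move=> x0 vx; rewrite vgeE ?vx.
have OX x n : vge v 0 x -> vge v 0 (x ^+ n) by move/(vgeX n); rewrite mul0rn.
have Oa := O _ a0 va; have OVa := vgeV a0 va.
have Oz := O _ z0 vz; have OVz := vgeV z0 vz.
have step1 : small (a - a ^+ k * z ^+ p).
  have -> : a - a ^+ k * z ^+ p = z ^+ p * (b ^+ k - a ^+ k) - (b' - a).
    by rewrite e mulrBr !(mulrC (z ^+ p)) opprB [RHS]addrC addrA subrK.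
  apply: smallB => //; apply: smallMl; first exact: OX.
  by apply: smallX => //; apply: O.
have step2 : small ((a / z) ^+ p - a ^+ l).
  have -> : (a / z) ^+ p - a ^+ l = a ^+ p.-1 / z ^+ p * (a - a ^+ k * z ^+ p).
    rewrite mulrBr expr_div_n; congr (_ - _).
      by rewrite mulrAC -exprSr prednK.
    by rewrite mulrCA divfK ?expf_neq0 // -exprD.
  by apply: smallMl => //; apply: vge0M; rewrite -?exprVn; apply: OX.
pose y := (a / z) ^+ u / a ^+ w.
have Oy : vge v 0 y by rewrite /y -exprVn vge0M ?OX ?vge0M.
apply: (not_small_root Oy); apply/smallN; rewrite opprB.
have -> : y ^+ p - a = (a ^+ (w * p))^-1 * (((a / z) ^+ p) ^+ u - (a ^+ l) ^+ u).
  rewrite /y expr_div_n -!exprM mulrBr mulrC [(u * p)%N]mulnC; congr (_ - _).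
  by rewrite [(l * u)%N]mulnC euw exprSr mulKf ?expf_neq0.
apply: smallMl; first by rewrite -exprVn OX.
by apply: smallX step2; rewrite OX // vge0M.
Qed.

Definition radicand (u : K * K) := a * (1 + u.1 ^+ p * (a - u.2 ^+ p)).

Lemma v_radicand m u : refines m u ->
  let e := u.1 ^+ p * (a - u.2 ^+ p) in e != 0 /\ v e = level u.
Proof.
move=> [t0 c0 _ _ _] e; have [nz vc] := delta_root c0.
by rewrite /e mulf_neq0 ?expf_neq0 // vfunM ?expf_neq0 // vfunX // vc /level mulrnDl.
Qed.

Lemma radicand_near m u : refines m u -> small (radicand u - a).
Proof.
move=> ru; have [e0 ve] := v_radicand ru; have [_ _ _ _ ab] := ru.
rewrite /radicand mulrDr mulr1 addrAC subrr add0r.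
apply: smallMl; first by rewrite vgeE ?v_a.1 // v_a.2.
by apply: small_above ab _; rewrite vgeE // ve.
Qed.

(** Write x and x' for the two perturbations. From
    1 + x' = (1 + x) z ^+ p and z ^+ p = 1 + (z - 1) ^+ p modulo p it follows
    that x' - (z - 1) ^+ p has value at least v x. Dividing by u'.1 ^+ p
    turns this bound into one above all delta c *+ p, and
    a is seen to be too close to (u'.2 + y) ^+ p with y = (z - 1) / u'.1. *)
Lemma radicand_distinct m m' u u' z : refines m u -> refines m' u' ->
  m' <= level u -> level u <= v p%:R -> v z = 0 -> z != 0 ->
  radicand u' != radicand u * z ^+ p.
Proof.
move=> ru ru' mu up vz z0; apply/eqP => e.
have [e0 ve] := v_radicand ru; have [e0' ve'] := v_radicand ru'.
set x := u.1 ^+ p * _ in e0 ve; set x' := u'.1 ^+ p * _ in e0' ve'.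
have {e} e : 1 + x' = (1 + x) * z ^+ p.
  by apply: (mulfI v_a.1); rewrite mulrA.
have Oz : vge v 0 z by rewrite vgeE ?vz.
have Oz1 := vgeB Oz (vge1 v).
have [w Ow ew] := expr_prime_addition pp (vge1 v) Oz1.
rewrite addrCA subrr addr0 expr1n in ew.
have [t0 c0 vt tlt ab] := ru'.
pose y := (z - 1) / u'.1.
have near_y : small (a - u'.2 ^+ p - y ^+ p).
  have h : vge v (level u) (x' - (z - 1) ^+ p).
    have -> : x' - (z - 1) ^+ p = p%:R * w + z ^+ p * x.
      apply: (addrI (1 + (z - 1) ^+ p)); rewrite addrACA subrr addr0 e.
      by rewrite addrA -ew mulrDl mul1r mulrC.
    apply: vgeD.
      by apply: vge_le up _; rewrite -[v _]addr0 vgeM // vgeE.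
    apply: vge0M; last by rewrite vgeE ?ve.
    by rewrite -(mul0rn _ p) vgeX.
  move=> c; have -> : a - u'.2 ^+ p - y ^+ p =
      (u'.1^-1) ^+ p * (x' - (z - 1) ^+ p).
    rewrite mulrBr /x' mulrA -exprMn mulVf // expr1n mul1r.
    by rewrite /y expr_div_n exprVn [_^-1 * _]mulrC.
  have -> : delta c *+ p = (- v u'.1) *+ p + (v u'.1 + delta c) *+ p.
    by rewrite -mulrnDl addKr.
  apply: vgtMr; first by apply: vgeX; rewrite vgeE ?invr_eq0 // vfunV.
  by apply: vge_gt h; apply: lt_le_trans mu; apply: tlt.
have Oy : vge v 0 y.
  have : vge v 0 (y ^+ p).
    have -> : y ^+ p = (a - u'.2 ^+ p) - (a - u'.2 ^+ p - y ^+ p).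
      by rewrite opprB addrC subrK.
    apply: vgeB; last by apply: vgtW; apply: small_vgt0.
    have OXc : vge v 0 (u'.2 ^+ p) by rewrite -(mul0rn _ p) vgeX.
    by rewrite vgeB // vgeE ?v_a.1 // v_a.2.
  have [->|y0] := eqVneq y 0; first by rewrite vge0.
  by rewrite !vgeE ?expf_neq0 // vfunX // -{1}(mul0rn _ p) og_lepMn.
have [w' Ow' ew'] := expr_prime_addition pp c0 Oy.
apply: (not_small_root (vgeD c0 Oy)); rewrite ew' !opprD !addrA.
apply: smallB => //; apply: small_vge_vp.
by rewrite -[v _]addr0 vgeM // vgeE.
Qed.

Definition refinement m : K * K := epsilon (inhabits 0) (refines m).

Lemma refinementP m : above m -> refines m (refinement m).
Proof. by move=> am; apply: epsilon_spec; apply: refinement_exists. Qed.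

Fixpoint threshold n : G :=
  if n is n'.+1 then level (refinement (threshold n')) else v p%:R.

Lemma threshold_above n : above (threshold n).
Proof. by elim: n => [|n IHn]; [apply: above_vp | case: (refinementP IHn)]. Qed.

Lemma threshold_le (m n : nat) : (m <= n)%N -> threshold n <= threshold m.
Proof.
move/subnK <-; elim: (n - m)%N => // k IHk; apply: le_trans IHk.
have [_ _ _ lt _] := refinementP (threshold_above (k + m)).
by rewrite addSn; apply: ltW; apply: lt.
Qed.

Lemma radicands_exist :
  exists b : nat -> K, (forall i, small (b i - a)) /\
    forall i j k z, i <> j -> b j <> b i ^+ k * z ^+ p.
Proof.
pose u i := refinement (threshold i).
have ru i : refines (threshold i) (u i) := refinementP (threshold_above i).
exists (fun i => radicand (u i)); split; first by move=> i; apply: radicand_near (ru i).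
have lt_dist i j z : (i < j)%N -> z != 0 -> v z = 0 ->
    radicand (u j) != radicand (u i) * z ^+ p.
  move=> ij z0 vz; apply: radicand_distinct (ru i) (ru j) _ _ vz z0.
    exact: (threshold_le ij).
  exact: (@threshold_le 0 i.+1).
move=> i j k z ij e.
have [z' [z0' vz'] e'] := Kummer_class_near
  (radicand_near (ru i)) (radicand_near (ru j)) e.
move/eqP: ij; rewrite neq_ltn => /orP[ij|ji].
  by have := lt_dist _ _ _ ij z0' vz'; rewrite e' eqxx.
have := lt_dist _ _ z'^-1 ji; rewrite invr_eq0 vfunV // vz' oppr0 e'.
by rewrite -mulrA -exprMn mulfV // expr1n mulr1 eqxx => /(_ z0' erefl).
Qed.

End Radicands.

(** * The distance of a super-dependent generator, and the theorem *)

(** That delta has no maximum is the fact that an immediate extension has no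
    best approximation: the residue of (eta - c) / e, where e in K has
    the value of eta - c, comes from K and yields a better approximation. *)
Lemma super_dependent_distance (K : fieldType) (G : orderedGroupType)
    (v : valuation K G) p (L : splittingFieldType K) :
  prime p -> p%:R != 0 :> K -> super_dependent_Kummer_ext v p L ->
  exists (delta : K -> G) (a : K) (beta : divHull G),
    [/\ forall c c', delta c < delta c' -> c' - c != 0 /\ v (c' - c) = delta c,
        forall c, exists c', delta c < delta c',
        0 < delta 1
      & forall y, vge v 0 y ->
          a - y ^+ p != 0 /\ v (a - y ^+ p) = delta y *+ p] /\
    (forall c, delta c *+ dh_den beta <= dh_num beta) /\
    dh_lt beta (dh_div (v p%:R) p).
Proof.
move=> pp pK [H [w [phi [[[_ _ [w_ext onto res] _] _]]]]].
case=> [eta [[eta1 etap _] unit_eta [beta [beta_le beta_lt]]]].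
have [mono wE] := w_ext.
have phi_inj : injective phi.
  by move=> g h e; apply: le_anti; rewrite -!mono e lexx.
have alg0 c : (c%:A == 0 :> L) = (c == 0).
  by rewrite scaler_eq0 oner_eq0 orbF.
have nz c : eta - c%:A != 0.
  by rewrite subr_eq0; apply: contraNneq eta1 => ->; rewrite rpredZ // mem1v.
have [delta deltaE] : exists delta : K -> G, forall c, phi (delta c) = w (eta - c%:A).
  exists (fun c => epsilon (inhabits 0) (fun g => phi g = w (eta - c%:A))) => c.
  exact: epsilon_spec (onto _).
have /vlineP[a ea] := etap.
have delta1 : 0 < delta 1.
  rewrite -(extends_lt w_ext) raddf0 deltaE -vgtE // scale1r.
  by move: unit_eta; rewrite /one_unit vgt_valideal.
have bound c : delta c *+ dh_den beta <= dh_num beta.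
  have := beta_le c; rewrite /dh_le /= mulr1n -deltaE -raddfMn mono.
  exact.
exists delta, a, beta; split=> //; split=> //.
- move=> c c' cc'.
  have near : vgt w (w (eta - c%:A)) (- (eta - c'%:A)).
    by rewrite vgtN vgtE // -!deltaE (extends_lt w_ext).
  have [] := vfunDl (nz c) near.
  rewrite opprB addrC addrA subrK -scalerBl alg0 => nz' wc.
  by split=> //; apply: phi_inj; rewrite -wE // wc deltaE.
- move=> c; have [e e0 ve] := vfun_onto v (delta c).
  have eA0 : e%:A != 0 :> L by rewrite alg0.
  set y := (eta - c%:A) / e%:A.
  have wy : w y = 0.
    by rewrite vfunM ?invr_eq0 // vfunV // wE // ve deltaE subrr.
  have y0 : y != 0 by rewrite mulf_neq0 ?invr_eq0.
  have Oy : y \in valring w by rewrite vge_valring vgeE ?wy.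
  have [x Ox rx] := res (residue w y).
  have Ox' : x%:A \in valring w.
    by rewrite vge_valring -(raddf0 phi); apply: (extends_vge w_ext).
  have /residueP near := esym rx.
  exists (c + x * e).
  have ge_e : vge w (phi (delta c)) e%:A by rewrite vgeE // wE // ve.
  have := vgtMr ge_e (near Oy Ox').
  rewrite addr0 mulrBr mulrC /y divfK // mulr_algl scalerA => h.
  rewrite -(extends_lt w_ext) (deltaE (c + x * e)) -vgtE ?nz //.
  by rewrite scalerDl opprD addrA [(x * e)%R]mulrC.
move=> y Oy; have Oy' : vge w 0 y%:A.
  by rewrite -(raddf0 phi); apply: (extends_vge w_ext).
have Oeta : vge w 0 eta.
  rewrite -(subrK 1 eta) vgeD ?vge1 //; apply: vgtW.
  by move: unit_eta; rewrite /one_unit vgt_valideal.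
have [z Oz] := expr_prime_addition pp (vgeB Oeta Oy') Oy'.
rewrite subrK ea => e.
have {}e : (eta - y%:A) ^+ p + p%:R * z = (a - y ^+ p)%:A.
  have -> : (a - y ^+ p)%:A = a%:A - y%:A ^+ p :> L.
    by rewrite scalerBl -(rmorphXn (in_alg L)).
  by rewrite e [_ + y%:A ^+ p + _]addrAC addrK.
have wX : w ((eta - y%:A) ^+ p) = phi (delta y *+ p).
  by rewrite vfunX // raddfMn deltaE.
have near : vgt w (w ((eta - y%:A) ^+ p)) (p%:R * z).
  rewrite wX; apply: (@vge_gt _ _ _ _ (phi (v p%:R))).
    by rewrite (extends_lt w_ext); exact: (delta_lt_vp pp bound beta_lt).
  rewrite -[phi _]addr0 vgeM // -(rmorph_nat (in_alg L)); apply: (extends_vge w_ext).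
  by rewrite vgeE.
have [] := vfunDl (expf_neq0 p (nz y)) near.
rewrite e alg0 => nz' wy; split=> //.
by apply: phi_inj; rewrite -wE // wy wX.
Qed.

Theorem theorem1p4 (K : fieldType) (G : orderedGroupType)
    (v : valuation K G) (p : nat)
    (v_rank1 : rank1 G)
    (charK : [pchar K] =i pred0)
    (charKv : p \in [pchar (residueField v)])
    (rootK : exists zeta : K, p.-primitive_root zeta)
    (admits_one : exists L : splittingFieldType K,
       super_dependent_Kummer_ext v p L) :
  exists L : nat -> splittingFieldType K,
    (forall i, super_dependent_Kummer_ext v p (L i)) /\
    (forall i j, i <> j -> ~ K_isomorphic (L i) (L j)).
Proof.
have pp : prime p by have := charKv; rewrite inE => /andP[].
have pK : p%:R != 0 :> K.
  by have := charK p; rewrite !inE pp /= => ->.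
have [zeta prim] := rootK; have [L0 sdL0] := admits_one.
have [delta [a [beta [[dB dmax d1 droot] [d_le beta_lt]]]]] :=
  super_dependent_distance pp pK sdL0.
have [b [near distinct]] := radicands_exist dB dmax d1 pp pK droot d_le beta_lt v_rank1.
have ext i : exists L : splittingFieldType K, super_dependent_Kummer_ext v p L /\
    exists eta : L, eta ^+ p = (b i)%:A /\ eta \notin 1%VS.
  have [b0 vb] := v_near_a d1 pp droot (near i).
  apply: (Kummer_extension_exists dB dmax d1 pp pK _ _ _ b0 prim d_le beta_lt).
  - exact: (delta_lt_vp pp d_le beta_lt).
  - by rewrite vgeE // vb.
  move=> c dc; have Oc := vge0_near dB d1 dc.
  have [nz vc] := droot c Oc.
  rewrite -vgeN opprB -(subrK a (b i)) -addrA vgeD //; first exact: vgtW (near i c).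
  by rewrite vgeE // vc.
pose L i := proj1_sig (constructive_indefinite_description _ (ext i)).
have LP i := proj2_sig (constructive_indefinite_description _ (ext i)).
exists L; split=> [i|i j ij iso]; first by case: (LP i).
have [_ [x [xp x1]]] := LP i.
have [[H [w [phi [[[gal dimL _ _] _] _]]]] [y [yp y1]]] := LP j.
have x0 : x != 0 by apply: contraNneq x1 => ->; rewrite mem0v.
have [k [z e]] := Kummer_isomorphic pp prim iso gal dimL xp x0 yp y1.
exact: distinct (not_eq_sym ij) e.
Qed.
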